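(* For $n \ge 1$, let $\mathrm{ST}_n(\mathbb{C})$ denote the group of $n\times n$ complex diagonal matrices with determinant $1$, identified with $\{\mathbf{a}=(a_1,\dots,a_n)\in(\mathbb{C}^* )^n : a_1\cdots a_n=1\}$. Let $G_n = \mathrm{ST}_n(\mathbb{C})\times \mathrm{ST}_n(\mathbb{C})\times \mathrm{ST}_n(\mathbb{C})$ act on $V_n=\mathbb{C}^n\otimes\mathbb{C}^n\otimes\mathbb{C}^n$ by $(\mathbf{a},\mathbf{b},\mathbf{c})\cdot u = v$ where $v_{ijk}=a_ib_jc_k u_{ijk}$. Assume $\mathrm{NP}\not\subseteq \mathrm{P/poly}$. Then there is no polynomial $q$ such that for every $n$ there exists a succinct encoding of a generating set of the invariant ring $\mathbb{C}[V_n]^{G_n}$ of size at most $q(n)$.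
   Context: For a group $G$ acting linearly on $V=\mathbb{C}^m$ with coordinate variables $x_1,\dots,x_m$, the invariant ring $\mathbb{C}[V]^G$ consists of polynomials $f$ with $f(g\cdot v)=f(v)$ for all $g\in G$, $v\in V$. An arithmetic circuit $\mathcal{C}(x_1,\dots,x_m,y_1,\dots,y_r)$ (using only rational constants) succinctly encodes generators of $\mathbb{C}[V]^G$ if the set of polynomials $\{\mathcal{C}(x_1,\dots,x_m,\alpha_1,\dots,\alpha_r)\}_{\alpha\in\mathbb{C}^r}$ is a generating set of $\mathbb{C}[V]^G$ as a $\mathbb{C}$-algebra. The size of such an encoding is the number of gates of the circuit plus the total bit complexity of the rational constants used in it. *)

(* Defs.v *)
From HB Require Import structures.
From mathcomp Require Import all_boot all_order all_algebra.
From mathcomp Require Import reals complex mpoly.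
Set Implicit Arguments.
Unset Strict Implicit.
Unset Printing Implicit Defensive.
Import Order.TTheory GRing.Theory Num.Theory.
Local Open Scope ring_scope.

(* Circuits are directed acyclic graphs listed in a topological order: gate
   number i may only refer to gates of number < i. *)

Fixpoint topological (gate : Type) (args : gate -> seq nat) (i : nat)
    (gs : seq gate) : bool :=
  if gs is g :: gs' then
    all (fun j => (j < i)%N) (args g) && topological args i.+1 gs'
  else true.

Definition gate_values (gate T : Type) (step : seq T -> gate -> T)
    (gs : seq gate) : seq T :=
  foldl (fun vs g => rcons vs (step vs g)) [::] gs.

Section ArithmeticCircuits.

Variables m r : nat.

Inductive agate :=
  | AX of 'I_m
  | AY of 'I_r
  | AConst of rat
  | AAdd of nat & nat
  | AMul of nat & nat.

Definition agate_args (g : agate) : seq nat :=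
  match g with
  | AAdd i j | AMul i j => [:: i; j]
  | _ => [::]
  end.

Record acircuit := ACircuit {
  agates : seq agate;
  aoutput : nat;
  _ : topological agate_args 0 agates && (aoutput < size agates)%N
}.

Definition bit_length (k : nat) : nat := (trunc_log 2 k).+1.

(* sign, numerator, denominator *)
Definition rat_bits (q : rat) : nat :=
  (1 + bit_length `|numq q| + bit_length `|denq q|)%N.

Definition agate_bits (g : agate) : nat :=
  if g is AConst q then rat_bits q else 0%N.

Definition acircuit_size (c : acircuit) : nat :=
  (size (agates c) + \sum_(g <- agates c) agate_bits g)%N.

Section Evaluation.

Variables (A : nzRingType) (cst : rat -> A) (x : 'I_m -> A) (y : 'I_r -> A).

Definition agate_step (vs : seq A) (g : agate) : A :=
  match g with
  | AX i => x i
  | AY j => y j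
  | AConst q => cst q
  | AAdd i j => vs`_i + vs`_j
  | AMul i j => vs`_i * vs`_j
  end.

Definition acircuit_eval (c : acircuit) : A :=
  (gate_values agate_step (agates c))`_(aoutput c).

End Evaluation.

(* The polynomial C(x_1, ..., x_m, alpha_1, ..., alpha_r). *)
Definition acircuit_poly (K : fieldType) (c : acircuit) (alpha : 'I_r -> K) :
    {mpoly K[m]} :=
  acircuit_eval (fun q => (ratr q)%:MP) (fun i => 'X_i)
                (fun j => (alpha j)%:MP) c.

End ArithmeticCircuits.

Section InvariantRings.

Variables (K : fieldType) (m : nat).

Definition invariant (G : Type) (act : G -> ('I_m -> K) -> ('I_m -> K))
    (f : {mpoly K[m]}) : Prop :=
  forall (g : G) (v : 'I_m -> K), f.@[act g v] = f.@[v].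

Definition generated_subalgebra (S : {mpoly K[m]} -> Prop)
    (f : {mpoly K[m]}) : Prop :=
  exists (k : nat) (s : k.-tuple {mpoly K[m]}) (P : {mpoly K[k]}),
    (forall i : 'I_k, S (tnth s i)) /\ f = P \mPo s.

Definition generates (S A : {mpoly K[m]} -> Prop) : Prop :=
  forall f, A f <-> generated_subalgebra S f.

Definition succinctly_encodes (G : Type)
    (act : G -> ('I_m -> K) -> ('I_m -> K)) (r : nat)
    (c : acircuit m r) : Prop :=
  generates (fun f => exists alpha : 'I_r -> K, f = acircuit_poly c alpha)
            (invariant act).

End InvariantRings.

Section TensorAction.

Variables (K : fieldType) (n : nat).

(* The diagonal matrix diag(a_1, ..., a_n) is represented by its diagonal. *)
Record ST := MkST {
  st_diag :> 'I_n -> K;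
  st_neq0 : forall i, st_diag i != 0;
  st_det1 : \prod_i st_diag i = 1
}.

(* K^n (x) K^n (x) K^n is K^(tensor_dim), the coordinates being numbered by an
   enumeration of the triples (i, j, k). *)
Definition tensor_dim : nat := #|{: 'I_n * 'I_n * 'I_n}|.

Definition tensor_act (g : ST * ST * ST) (u : 'I_tensor_dim -> K) :
    'I_tensor_dim -> K :=
  fun l =>
    let: (a, b, c) := g in
    let: (i, j, k) := enum_val l in
    a i * b j * c k * u l.

End TensorAction.

Definition language := seq bool -> Prop.

(* Nondeterministic Turing machines with one tape, infinite to the right.  A
   cell contains the blank None, an input bit Some (inl b), or a work symbol
   Some (inr w).  A machine halts when no transition applies. *)

Inductive move := MoveLeft | MoveStay | MoveRight.

Record ntm := NTM {
  ntm_state : finType;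
  ntm_work : finType;
  ntm_start : ntm_state;
  ntm_accept : pred ntm_state;
  ntm_trans : ntm_state -> option (bool + ntm_work) ->
              ntm_state -> option (bool + ntm_work) -> move -> bool
}.

Section TuringMachines.

Variable M : ntm.

Definition symbol : Type := option (bool + ntm_work M).

Record config := Config {
  cstate : ntm_state M;
  chead : nat;
  ctape : nat -> symbol
}.

Definition init_config (w : seq bool) : config :=
  Config (ntm_start M) 0
    (fun p => if (p < size w)%N then Some (inl (nth false w p)) else None).

(* A left move from the leftmost cell leaves the head in place. *)
Definition move_head (d : move) (p : nat) : nat :=
  match d with
  | MoveLeft => p.-1
  | MoveStay => p
  | MoveRight => p.+1
  end.

Definition step (c c' : config) : Prop :=
  exists (s : ntm_state M) (a : symbol) (d : move),
    ntm_trans (cstate c) (ctape c (chead c)) s a d /\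
    c' = Config s (move_head d (chead c))
           (fun p => if p == chead c then a else ctape c p).

Fixpoint steps (t : nat) (c c' : config) : Prop :=
  if t is t'.+1 then exists2 c1, step c c1 & steps t' c1 c' else c = c'.

Definition halted (c : config) : Prop := forall c', ~ step c c'.

Definition ntm_accepts (w : seq bool) : Prop :=
  exists (t : nat) (c : config),
    [/\ steps t (init_config w) c, halted c & ntm_accept (cstate c)].

Definition runs_in_time (T : nat -> nat) : Prop :=
  forall (w : seq bool) (t : nat) (c : config),
    steps t (init_config w) c -> (t <= T (size w))%N.

End TuringMachines.

Definition NP (L : language) : Prop :=
  exists (M : ntm) (p : {poly nat}),
    runs_in_time M (fun n => p.[n]) /\ forall w, L w <-> ntm_accepts M w.

Section BooleanCircuits.

Variable n : nat.

Inductive bgate :=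
  | BIn of 'I_n
  | BConst of bool
  | BNot of nat
  | BAnd of nat & nat
  | BOr of nat & nat.

Definition bgate_args (g : bgate) : seq nat :=
  match g with
  | BNot i => [:: i]
  | BAnd i j | BOr i j => [:: i; j]
  | _ => [::]
  end.

Record bcircuit := BCircuit {
  bgates : seq bgate;
  boutput : nat;
  _ : topological bgate_args 0 bgates && (boutput < size bgates)%N
}.

Definition bgate_step (x : 'I_n -> bool) (vs : seq bool) (g : bgate) : bool :=
  match g with
  | BIn i => x i
  | BConst b => b
  | BNot i => ~~ nth false vs i
  | BAnd i j => nth false vs i && nth false vs j
  | BOr i j => nth false vs i || nth false vs j
  end.

Definition bcircuit_eval (c : bcircuit) (x : 'I_n -> bool) : bool :=
  nth false (gate_values (bgate_step x) (bgates c)) (boutput c).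

End BooleanCircuits.

Definition Ppoly (L : language) : Prop :=
  exists p : {poly nat}, forall n : nat,
    exists2 c : bcircuit n,
      (size (bgates c) <= p.[n])%N &
      forall w : n.-tuple bool, L w <-> bcircuit_eval c (tnth w).

(* Main.v *)
Require Import Defs.
From HB Require Import structures.
From mathcomp Require Import all_boot all_order all_algebra.
From mathcomp Require Import boolp reals complex mpoly zify.

(* Suppose that generators have polynomial-size encodings.  A monomial is
   invariant iff its exponent tensor has constant marginals in each of the three
   directions, so the invariants of least positive degree n are spanned by the
   monomials of the perfect matchings of [n]^3.  Since the generators must span
   them modulo decomposable elements, which have higher degree, a set S of
   triples contains a perfect matching iff the coefficient of t^n in
   C(t 1_S, alpha) is nonzero for some alpha.

   A circuit of size s has degree at most 2^s, so one integer point alpha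
   detects all S simultaneously, and the resulting nonzero integers, of doubly
   exponential size, are all nonzero modulo a single number with polynomially
   many bits.  Boolean circuits of polynomial size can therefore decide
   three-dimensional matching.

   A polynomial-time nondeterministic computation is a constraint satisfaction
   problem whose constraints equate labels of pairs of variables; this is an
   exact cover problem, which is a three-dimensional matching problem in which
   the presence of a triple depends on at most one input bit.  Hence NP would
   be contained in P/poly. *)

Set Implicit Arguments.
Unset Strict Implicit.
Unset Printing Implicit Defensive.
Import Order.TTheory GRing.Theory Num.Theory.

(** The matching is indexed by its middle coordinates. On a finite type the injections [s] and [t]
    are bijections, so every element occurs exactly once in each coordinate. *)
Definition perfect_matching (T : Type) (S : T -> T -> T -> bool) : Prop :=
  exists s t : T -> T,
    [/\ injective s, injective t & forall y, S (s y) y (t y)].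

Lemma perfect_matching_bij (T T' : Type) (S : T -> T -> T -> bool)
    (f : T -> T') (g : T' -> T) : cancel f g -> cancel g f ->
  perfect_matching S <->
  perfect_matching (fun x y z => S (g x) (g y) (g z)).
Proof.
move=> fK gK; split=> -[s [t [s_inj t_inj sS]]].
  exists (f \o s \o g), (f \o t \o g); split=> [x y|x y|y] /=.
  - by move/(can_inj fK)/s_inj/(can_inj gK).
  - by move/(can_inj fK)/t_inj/(can_inj gK).
  - by rewrite !fK; apply: sS.
exists (g \o s \o f), (g \o t \o f); split=> [x y|x y|y] /=.
- by move/(can_inj gK)/s_inj/(can_inj fK).
- by move/(can_inj gK)/t_inj/(can_inj fK).
- by have := sS (f y); rewrite !fK.
Qed.

(** * Exact covers as perfect matchings *)

(** [P] passes from each index to its cyclic predecessor: from [i] it descends to 0, wraps round to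
    the maximum, and descends from there to [j]. *)
Lemma ordS_closed n (P : pred 'I_n) :
  (forall i, P (ordS i) -> P i) -> forall i j, P i -> P j.
Proof.
case: n P => [|n] P PS i j; first by case: i.
have down d (a b : 'I_n.+1) : (a = b + d :> nat)%N -> P a -> P b.
  elim: d a b => [|d IH] a b.
    by rewrite addn0 => /val_inj ->.
  move=> ab Pa; apply: PS; apply: IH Pa; rewrite /= modn_small; have := ltn_ord a; lia.
move=> Pi; have P0 : P ord0 by apply: (down i) Pi.
have Pn : P ord_max.
  have ordS0 : ordS ord_max = ord0 :> 'I_n.+1 by apply: val_inj; rewrite /= modnn.
  by apply: PS; rewrite ordS0.
by apply: (down (n - j)%N) Pn => /=; have := ltn_ord j; lia.
Qed.

Section CyclicSuccessor.

Variable U : finType.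

Definition cyc_succ (u : U) : U := enum_val (ordS (enum_rank u)).

Lemma cyc_succ_inj : injective cyc_succ.
Proof. by move=> u v /enum_val_inj /(bij_inj (@ordS_bij _)) /enum_rank_inj. Qed.

Lemma cyc_succ_closed (P : pred U) :
  (forall u, P (cyc_succ u) -> P u) -> forall u v, P u -> P v.
Proof.
move=> PS u v Pu; rewrite -(enum_rankK v).
apply: (@ordS_closed _ (fun i => P (enum_val i)) _ (enum_rank u)); last first.
  by rewrite enum_rankK.
by move=> i Pi; apply: PS; rewrite /cyc_succ enum_valK.
Qed.

End CyclicSuccessor.

Section ExactCover.

Variables (A U : finType) (mem : A -> pred U) (ok : pred A).

Definition exact_cover : Prop :=
  exists ch : pred A, (forall a, ch a -> ok a) /\
    forall u, exists a, [/\ ch a, mem a u &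
                            forall a', ch a' -> mem a' u -> a' = a].

Definition cover_vertex : finType := ((A * U) + U)%type.

Definition chosen_triple (x : cover_vertex) a u (z : cover_vertex) : bool :=
  [&& x == inl (a, u), ok a & z == if mem a u then inr u else inl (a, u)].

(* Each set [a] has a wheel: the middle vertices [(a, u)] are matched either
   all with [(a, u)] (then [a] is chosen, and the third coordinates of its
   members are elements of the universe) or all with [(a, cyc_succ u)] (then
   they use up [(a, u)] in the third coordinate).  The vertices [inr u] collect
   the third coordinates left over by the chosen sets. *)
Definition cover_triple (x y z : cover_vertex) : bool :=
  match y with
  | inl (a, u) => chosen_triple x a u z
                  || (x == inl (a, cyc_succ u)) && (z == inl (a, u))
  | inr u => (x == inr u) && (if z is inl _ then true else false)
  end.

Lemma exact_cover_matching :
  exact_cover -> perfect_matching cover_triple.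
Proof.
case=> ch [ch_ok /choice [c cP]].
pose s (y : cover_vertex) : cover_vertex :=
  match y with
  | inl (a, u) => if ch a then inl (a, u) else inl (a, cyc_succ u)
  | inr u => inr u
  end.
(* The chosen set [c u] covering [u] trades its third coordinate [(c u, u)] for [inr u]; the middle
   vertex [inr u] takes over the coordinate given up. *)
pose t (y : cover_vertex) : cover_vertex :=
  match y with
  | inl (a, u) => if ch a && mem a u then inr u else inl (a, u)
  | inr u => inl (c u, u)
  end.
exists s, t; split.
- case=> [[a u]|u] [[b v]|v] /=; last by [].
  + case: ifP => cha; case: ifP => chb [ab uv]; subst; rewrite ?uv //.
    * by rewrite cha in chb.
    * by rewrite chb in cha.
    * by rewrite (cyc_succ_inj uv).
  + by case: ifP.
  + by case: ifP.
- case=> [[a u]|u] [[b v]|v] /=.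
  + case Ea: (ch a && mem a u); case Eb: (ch b && mem b v) => //.
    case=> uv; subst v; have [_ _ cU] := cP u.
    by case/andP: Ea => cha ma; case/andP: Eb => chb mb; rewrite (cU _ cha ma) (cU _ chb mb).
  + case: ifP => // nab [ab uv]; subst; have [h1 h2 _] := cP v.
    by rewrite h1 h2 in nab.
  + case: ifP => // nab [ab uv]; subst; have [h1 h2 _] := cP v.
    by rewrite h1 h2 in nab.
  + by case=> _ ->.
- case=> [[a u]|u] /=; last by rewrite eqxx.
  rewrite /chosen_triple; case cha: (ch a) => /=; last by rewrite !eqxx orbT.
  by rewrite eqxx (ch_ok _ cha) eqxx.
Qed.

Lemma matching_exact_cover :
  perfect_matching cover_triple -> exact_cover.
Proof.
case=> s [t [s_inj t_inj stP]].
pose good a u := chosen_triple (s (inl (a, u))) a u (t (inl (a, u))).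
(* When [(a, cyc_succ u)] is in chosen position it occupies its own first coordinate, which by
   injectivity of [s] the alternative triple of [(a, u)] cannot use as well. Hence a wheel is chosen
   everywhere or nowhere. *)
have good_all a u v : good a u -> good a v.
  apply: (@cyc_succ_closed _ (good a)) => {u v} u gu.
  have := stP (inl (a, u)) => /= /orP [//|/andP[/eqP su _]].
  have := gu; rewrite {1}/good => /and3P[/eqP su' _ _].
  suff <- : cyc_succ u = u by [].
  by rewrite -su' in su; case/s_inj: su.
exists (fun a => [exists u, good a u]); split=> [a /existsP[u /and3P[]] //|u].
(* [t] is surjective, so some middle vertex has third coordinate [inr u]. Only a chosen triple of a
   set containing [u] has this form, and injectivity of [t] makes that set unique. *)
have [t' t'K tK'] : bijective t by apply: injF_bij.
have := tK' (inr u); set y := t' _ => ty.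
have := stP y; case: y ty => [[a v]|v] /= ty; last by rewrite ty andbF.
rewrite ty andbF orbF => gav.
have [eqvu mav] : v = u /\ mem a v.
  by case/and3P: gav => _ _; case: ifP => // _ /eqP[->].
subst v; exists a; split=> //; first by apply/existsP; exists u; rewrite /good ty.
move=> b /existsP[v /(good_all _ _ u)] /and3P[_ _ + mb].
by rewrite mb -ty => /eqP /t_inj [].
Qed.

End ExactCover.

(** * Constraint satisfaction with label equalities *)

Section LabelCSP.

Variables (V D E C : finType) (ok : V -> D -> bool).
Variables (src tgt : E -> V) (lsrc ltgt : E -> D -> C).

Definition csp : Prop :=
  exists x : V -> D, (forall v, ok v (x v)) /\
    forall e, lsrc e (x (src e)) = ltgt e (x (tgt e)).

(* Of the elements [(e, c)], the value at the source of [e] covers all but the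
   one with its own label, and the value at the target exactly that one. *)
Definition csp_mem (a : V * D) (u : V + E * C) : bool :=
  match u with
  | inl v => a.1 == v
  | inr (e, c) => (src e == a.1) && (lsrc e a.2 != c)
                  || (tgt e == a.1) && (ltgt e a.2 == c)
  end.

Lemma csp_exact_cover :
  csp <-> exact_cover csp_mem (fun a => ok a.1 a.2).
Proof.
split.
  case=> x [xok xE]; exists (fun a => a.2 == x a.1); split.
    by case=> v d /= /eqP ->.
  case=> [v|[e c]] /=.
    exists (v, x v); split=> //=.
    by case=> v' d /= /eqP -> /eqP ->.
  have [cE|cN] := eqVneq (lsrc e (x (src e))) c.
    exists (tgt e, x (tgt e)); split=> //=; first by rewrite eqxx -xE cE eqxx orbT.
    case=> v d /= /eqP -> /orP [] /andP[/eqP <-]; last by [].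
    by rewrite cE eqxx.
  exists (src e, x (src e)); split=> //=; first by rewrite eqxx cN.
  case=> v d /= /eqP -> /orP [] /andP[/eqP <-] //.
  by rewrite -xE (negPf cN).
case=> ch [ch_ok chU].
have /choice[x xP] : forall v, exists d, ch (v, d) /\
    forall d', ch (v, d') -> d' = d.
  move=> v; have [[v' d] [/= chd /eqP ? dU]] := chU (inl v); subst v'.
  exists d; split=> // d' chd'.
  by have [] := dU (v, d') chd' (eqxx _).
exists x; split=> [v|e]; first by apply: (ch_ok (v, x v)); case: (xP v).
(* The value at the source leaves uncovered exactly the element carrying its own label, so the set
   covering this element comes from the target and has the same label. *)
have [[v d] [/= chd mvd _]] := chU (inr (e, lsrc e (x (src e)))).
have [_ xU] := xP v; have dE := xU _ chd; subst d.
by case/orP: mvd => /andP[/eqP <-]; [rewrite eqxx | move/eqP].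
Qed.

End LabelCSP.

(** * Turing machine runs as constraint satisfaction *)

(** Tableau entries must lie in finite types; [option bool] is a finite stand-in for [move]. *)
Definition dir_move (o : option bool) : move :=
  match o with
  | None => MoveStay
  | Some false => MoveLeft
  | Some true => MoveRight
  end.

Lemma dir_move_surj d : exists o, dir_move o = d.
Proof. by case: d; [exists (Some false) | exists None | exists (Some true)]. Qed.

Section Tableau.

Variable M : ntm.

Local Notation Q := (ntm_state M).
Local Notation Sy := (option (bool + ntm_work M)).

Definition action : finType := (Q * Sy * option bool)%type.

Definition halting (q : Q) (a : Sy) : bool :=
  [forall s : Q, forall b : Sy, forall o : option bool,
     ~~ ntm_trans q a s b (dir_move o)].

(* A machine that has halted in an accepting state idles forever, so that it
   accepts if and only if it has a run of length exceeding the time bound. *)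
Definition idle_trans (q : Q) (a : Sy) (r : action) : bool :=
  ntm_trans q a r.1.1 r.1.2 (dir_move r.2)
  || [&& halting q a, ntm_accept q & r == (q, a, None)].

Definition apply_action (r : action) (c : config M) : config M :=
  Config r.1.1 (move_head (dir_move r.2) (chead c))
    (fun p => if p == chead c then r.1.2 else ctape c p).

Fixpoint run (r : nat -> action) (c : config M) (t : nat) : config M :=
  if t is t'.+1 then apply_action (r t') (run r c t') else c.

Definition good_run (k : nat) (r : nat -> action) (c : config M) : Prop :=
  forall t, (t < k)%N ->
    idle_trans (cstate (run r c t)) (ctape (run r c t) (chead (run r c t))) (r t).

Lemma haltingP (c : config M) :
  halting (cstate c) (ctape c (chead c)) <-> halted c.
Proof.
split.
  move=> /forallP hP c' [s [a [d [tr _]]]].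
  have [o od] := dir_move_surj d; subst d.
  by have /forallP/(_ a)/forallP/(_ o)/negP := hP s.
move=> hc; apply/forallP => s; apply/forallP => b; apply/forallP => o.
apply/negP => tr; apply: (hc (apply_action (s, b, o) c)).
by exists s, b, (dir_move o).
Qed.

Lemma runS r c t :
  run r c t.+1 = run (fun i => r i.+1) (apply_action (r 0%N) c) t.
Proof. by elim: t => [//|t IH]; rewrite -[LHS]/(apply_action (r t.+1) (run r c t.+1)) IH. Qed.

Lemma steps_good_run t c c' k : steps t c c' -> halted c' -> ntm_accept (cstate c') ->
  exists r, good_run k r c.
Proof.
move=> + hc' ac'; elim: t c k => [|t IH] c k /=.
  move=> ->; exists (fun=> (cstate c', ctape c' (chead c'), None)).
  have run_id i : run (fun=> (cstate c', ctape c' (chead c'), None)) c' i = c'.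
    elim: i => [//|i /= ->]; rewrite /apply_action /=.
    case: (c') => q h T /=; congr Config; apply/funext => p.
    by case: eqP => [->|].
  by move=> i _; rewrite run_id /idle_trans ac' eqxx (introT idP (proj2 (haltingP _) hc')) orbT.
case=> c1 [s [a [d [tr c1E]]]] /IH {}IH.
case: k => [|k]; first by exists (fun=> (s, a, None)).
have [r rP] := IH k; have [o od] := dir_move_surj d; subst d.
exists (fun i => if i is i'.+1 then r i' else (s, a, o)) => -[_|i ik].
  by rewrite /idle_trans /= tr.
by rewrite runS /apply_action /= -c1E; apply: rP.
Qed.

Lemma steps_rcons t (c c1 c2 : config M) : steps t c c1 -> step c1 c2 -> steps t.+1 c c2.
Proof.
elim: t c => [|t IH] c /=; first by move=> -> st; exists c2.
by case=> c' cc' /IH h /h; exists c'.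
Qed.

(** A run longer than the time bound cannot consist of genuine transitions only, so it idles at some
    time, and idling is possible only in a halted accepting configuration. Conversely, an accepting
    computation is prolonged by idling. *)
Lemma accepts_good_run (T : nat -> nat) (w : seq bool) : runs_in_time M T ->
  ntm_accepts M w <-> exists r, good_run (T (size w)).+1 r (init_config M w).
Proof.
move=> MT; split=> [[t [c [st hc ac]]]|[r rP]].
  exact: steps_good_run st hc ac.
have : forall t, (t <= (T (size w)).+1)%N ->
    steps t (init_config M w) (run r (init_config M w) t) \/ ntm_accepts M w.
  elim=> [|t IH] tk; first by left.
  have [st|] := IH (ltnW tk); last by right.
  have /orP[tr|/and3P[hl ac _]] := rP t tk.
    by left; apply: steps_rcons st _; exists (r t).1.1, (r t).1.2, (dir_move (r t).2).
  by right; exists t, (run r (init_config M w) t); split=> //; apply/haltingP.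
move=> /(_ _ (leqnn _)) [st|//].
by have := MT _ _ _ st; rewrite ltnn.
Qed.

Variable k : nat.

Definition row : finType := (Q * 'I_k.+1 * Sy * action)%type.
Definition cell : finType := (Sy * Sy * option (Sy * Sy))%type.
Definition tab_var : finType := ('I_k + 'I_k * 'I_k)%type.
Definition tab_val : finType := (row + cell)%type.
Definition tab_edge : finType := ('I_k + ('I_k * 'I_k + 'I_k * 'I_k))%type.
Definition tab_label : finType :=
  option (Q * 'I_k.+1 + (Sy + option (Sy * Sy))).

(* The variable [inl t] is the transition [(q, h, a, r)] made at time [t] by
   the head at position [h], in state [q], reading [a]; the variable
   [inr (t, p)] holds the contents of cell [p] at times [t] and [t + 1], and
   the symbols read and written there if the head is at [p]. *)
Definition tab_ok (init : nat -> Sy) (v : tab_var) (d : tab_val) : bool :=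
  match v, d with
  | inl t, inl (q, h, a, r) =>
      idle_trans q a r
      && ((t == 0 :> nat)%N ==> (q == ntm_start M) && (h == 0 :> nat)%N)
  | inr (t, p), inr (y, y', o) =>
      (if o is Some (a, b) then (y == a) && (y' == b) else y == y')
      && ((t == 0 :> nat)%N ==> (y == init p))
  | _, _ => false
  end.

Definition tab_src (e : tab_edge) : tab_var :=
  match e with
  | inl t | inr (inr (t, _)) => inl t
  | inr (inl tp) => inr tp
  end.

(** [ordS] is cyclic, so edges starting at the last time lead back to time 0. The test [t.+1 < k] in
    the labels below neutralises them by giving both ends the label [None]. *)
Definition tab_tgt (e : tab_edge) : tab_var :=
  match e with
  | inl t => inl (ordS t)
  | inr (inl (t, p)) => inr (ordS t, p)
  | inr (inr tp) => inr tp
  end.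

Definition tab_lsrc (e : tab_edge) (d : tab_val) : tab_label :=
  match e, d with
  | inl t, inl (_, h, _, r) =>
      if (t.+1 < k)%N then Some (inl (r.1.1, inord (move_head (dir_move r.2) h)))
      else None
  | inr (inl (t, _)), inr (_, y', _) =>
      if (t.+1 < k)%N then Some (inr (inl y')) else None
  | inr (inr (_, p)), inl (_, h, a, r) =>
      Some (inr (inr (if h == p :> nat then Some (a, r.1.2) else None)))
  | _, _ => None
  end.

Definition tab_ltgt (e : tab_edge) (d : tab_val) : tab_label :=
  match e, d with
  | inl t, inl (q, h, _, _) => if (t.+1 < k)%N then Some (inl (q, h)) else None
  | inr (inl (t, _)), inr (y, _, _) =>
      if (t.+1 < k)%N then Some (inr (inl y)) else None
  | inr (inr _), inr (_, _, o) => Some (inr (inr o))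
  | _, _ => None
  end.

Definition tab_csp (init : nat -> Sy) : Prop :=
  csp (tab_ok init) tab_src tab_tgt tab_lsrc tab_ltgt.

(** The head advances at most one cell per step, so at times below [k] it stays within the first [k]
    cells, and a square tableau suffices. *)
Lemma run_head_le r c t : chead c = 0%N -> (chead (run r c t) <= t)%N.
Proof.
move=> c0; elim: t => [|t IH] /=; first by rewrite c0.
by case: (r t).2 => [[]|] /=; lia.
Qed.

Variable w : seq bool.
Local Notation c0 := (init_config M w).

Lemma good_run_tab r : good_run k r c0 -> tab_csp (ctape c0).
Proof.
move=> rP.
pose x (v : tab_var) : tab_val :=
  match v with
  | inl t => let c := run r c0 t in
      inl (cstate c, inord (chead c), ctape c (chead c), r t)
  | inr (t, p) => let c := run r c0 t in
      inr (ctape c p, ctape (run r c0 t.+1) p,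
           if chead c == p then Some (ctape c p, (r t).1.2) else None)
  end.
have headK (t : 'I_k) : (@inord k (chead (run r c0 t)) = chead (run r c0 t) :> nat).
  by rewrite inordK //; have := @run_head_le r c0 t erefl; have := ltn_ord t; lia.
exists x; split.
  case=> [t|[t p]] /=.
    rewrite rP //=; apply/implyP => /eqP t0.
    by rewrite headK t0 /= eqxx.
  apply/andP; split; last by apply/implyP => /eqP ->.
  case: eqP => [->|/eqP hp]; first by rewrite !eqxx.
  by rewrite [nat_of_ord p == _]eq_sym (negPf hp).
case=> [t|[[t p]|[t p]]] /=.
- case: ifP => // tk; rewrite modn_small //=.
  by rewrite headK.
- by case: ifP => // tk; rewrite modn_small.
- rewrite headK; case: eqP => [->|] //.
Qed.

Lemma tab_good_run : tab_csp (ctape c0) -> exists r, good_run k r c0.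
Proof.
case=> x [xok xE].
pose r (t : nat) : action :=
  if insub t is Some i then
    if x (inl i) is inl (_, _, _, r) then r else (ntm_start M, None, None)
  else (ntm_start M, None, None).
(* The actions stored in the rows are replayed; by induction on time, rows and cells record the
   state, head and tape of this run. The invariant does not yet say that the symbol [a] stored in
   the row is the one on the tape. *)
pose inv (i : 'I_k) := let c := run r c0 i in
  (exists (h : 'I_k.+1) a, [/\ x (inl i) = inl (cstate c, h, a, r i), h = chead c :> nat &
     idle_trans (cstate c) a (r i)]) /\
  (forall p : 'I_k, exists y' o, x (inr (i, p)) = inr (ctape c p, y', o)).
have rowE (i : 'I_k) : exists q h a, [/\ x (inl i) = inl (q, h, a, r i),
    idle_trans q a (r i) &
    (i == 0 :> nat)%N ==> (q == ntm_start M) && (h == 0 :> nat)%N].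
  have := xok (inl i); rewrite /r valK /=.
  case: (x (inl i)) => [[[[q h] a] s]|//] /andP[tr i0].
  by exists q, h, a.
have cellE (i p : 'I_k) : exists y y' o, [/\ x (inr (i, p)) = inr (y, y', o),
     is_true (if o is Some (a, b) then (y == a) && (y' == b) else y == y') &
     (i == 0 :> nat)%N ==> (y == ctape c0 p)].
  have := xok (inr (i, p)) => /=.
  case: (x (inr (i, p))) => [//|[[y y'] o]] /andP[tr i0].
  by exists y, y', o.
have headlt (i : 'I_k) : (chead (run r c0 i) < k)%N.
  by have := @run_head_le r c0 i erefl; have := ltn_ord i; lia.
have step_inv (i : 'I_k) : inv i ->
    idle_trans (cstate (run r c0 i)) (ctape (run r c0 i) (chead (run r c0 i))) (r i)
    /\ forall p : 'I_k, exists y o, x (inr (i, p)) = inr (y, ctape (run r c0 i.+1) p, o).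
  case=> [[h [a [xi hE tr]]] cells].
  have cellp (p : 'I_k) : exists y', x (inr (i, p)) =
      inr (ctape (run r c0 i) p, y',
           if h == p :> nat then Some (a, (r i).1.2) else None).
    have [y' [o xip]] := cells p; exists y'.
    by have := xE (inr (inr (i, p))); rewrite /= xi xip /= => -[->].
  split.
    (* The edge between the row and the cell under the head identifies the symbol that the row
       claims to read with the one on the tape. *)
    have [y' xip] := cellp (Ordinal (headlt i)).
    have [y1 [y2 [o [xip2 oP _]]]] := cellE i (Ordinal (headlt i)).
    move: xip; rewrite xip2 /= hE eqxx => -[e1 e2 e3]; subst.
    by case/andP: oP => /eqP ->.
  move=> p; have [y' xip] := cellp p.
  have [y1 [y2 [o [xip2 oP _]]]] := cellE i p.
  exists (ctape (run r c0 i) p), (if h == p :> nat then Some (a, (r i).1.2) else None).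
  rewrite xip /=; do 3 congr pair || congr inr.
  move: xip; rewrite xip2 => -[e1 e2 e3]; subst.
  rewrite -hE [(nat_of_ord p == h)]eq_sym; case: ifP oP => _ /=.
    by case/andP=> _ /eqP.
  by move/eqP.
have invP (t : nat) (i : 'I_k) : i = t :> nat -> inv i.
  elim: t i => [|t IH] i it.
    split.
      have [q [h [a [xi tr]]]] := rowE i; rewrite it /= => /andP[/eqP qE /eqP hE].
      by exists h, a; rewrite xi it /= qE hE -it; split=> //; rewrite -qE.
    move=> p; have [y [y' [o [xip _]]]] := cellE i p.
    by rewrite it /= => /eqP yE; exists y', o; rewrite xip yE.
  have tk : (t < k)%N by have := ltn_ord i; lia.
  pose j : 'I_k := Ordinal tk.
  have jS : ordS j = i.
    by apply: val_inj; rewrite /= modn_small -it.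
  have jk : (j.+1 < k)%N by rewrite /= -it.
  have invj := IH j erefl.
  have [tr cells] := step_inv j invj.
  have [[h [a [xj hE trj]]] _] := invj.
  split.
    have [q [h' [b [xi tri _]]]] := rowE i.
    exists h', b; have := xE (inl j); rewrite /= jS xj xi /= jk => -[qE hh].
    rewrite it /= -/(run r c0 t) -it; split.
    - by rewrite qE.
    - rewrite -hh inordK ?hE //.
      have := @run_head_le r c0 j.+1 erefl; rewrite /= .
      by have := ltn_ord i; lia.
    - by rewrite qE.
  move=> p; have [y1 [y2 [o [xip _ _]]]] := cellE i p.
  have [y [o' xjp]] := cells p.
  have := xE (inr (inl (j, p))); rewrite /= jS xip xjp jk => -[yE].
  by exists y2, o; rewrite -yE it.
by exists r => t tk; have [] := step_inv (Ordinal tk) (invP t (Ordinal tk) erefl).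
Qed.

End Tableau.

Local Open Scope ring_scope.

(** * Nonvanishing on a grid *)

Lemma poly_grid (K : numFieldType) (p : {poly K}) (d : nat) : p != 0 ->
  (size p <= d)%N -> exists2 a : nat, (a < d)%N & p.[a%:R] != 0.
Proof.
move=> p0 pd; apply: contrapT => no_a.
pose rs := [seq a%:R : K | a <- iota 0 d].
suff : (size rs < size p)%N by rewrite size_map size_iota; lia.
apply: max_poly_roots => //; last first.
  by rewrite map_inj_uniq ?iota_uniq // => i j /eqP; rewrite eqr_nat => /eqP.
apply/allP => x /mapP[a]; rewrite mem_iota /= add0n => ad ->.
by rewrite rootE; apply/negP => pa; apply: no_a; exists a => //; apply/negP.
Qed.

Lemma lift_max_widen n (i : 'I_n) : lift ord_max i = widen_ord (leqnSn n) i.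
Proof. by apply: val_inj; exact: lift_max. Qed.

Section MuniCoef.

Variables (R : comNzRingType) (n : nat).
Implicit Types (p : {mpoly R[n.+1]}).

Local Notation wid := (widen_ord (leqnSn n)).

Lemma mnm_ord_maxP (m m' : 'X_{1..n.+1}) :
  (forall i, m (wid i) = m' (wid i)) -> m ord_max = m' ord_max -> m = m'.
Proof.
move=> mw mmax; apply/mnmP => i; have [j ->|->] := unliftP ord_max i; last by [].
by rewrite lift_max_widen mw.
Qed.

Lemma muni_coef p (m : 'X_{1..n.+1}) :
  (muni p)`_(m ord_max)@_[multinom m (wid i) | i < n] = p@_m.
Proof.
rewrite muniE coef_sum raddf_sum /= [RHS](_ : _ = (\sum_(m' <- msupp p) p@_m' *: 'X_[m'])@_m).
  rewrite raddf_sum /=; apply: eq_bigr => m' _.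
  rewrite coefZ coefXn mcoeffZ mcoeffX.
  have [mm|nmm] := eqVneq m' m.
    by subst; rewrite !eqxx mulr1 mcoeffZ mcoeffX eqxx.
  have [e1|] := eqVneq (m ord_max) (m' ord_max); last by rewrite !mulr0 mcoeff0.
  rewrite mulr1 mcoeffZ mcoeffX; case: eqP => [e2|]; last by [].
  case/eqP: nmm; apply: mnm_ord_maxP => // i.
  by have /mnmP/(_ i) := e2; rewrite !mnmE.
by rewrite -mpolyE.
Qed.

Lemma muni_eval p (v : 'I_n.+1 -> R) :
  p.@[v] = (map_poly (meval (v \o wid)) (muni p)).[v ord_max].
Proof.
rewrite muniE rmorph_sum /= horner_sum mevalE; apply: eq_bigr => m _.
rewrite map_polyZ /= map_polyXn hornerZ hornerXn mevalZ mevalX -mulrA; congr (_ * _).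
rewrite big_ord_recr /=; congr (_ * _ ).
by apply: eq_bigr => i _; rewrite mnmE.
Qed.

End MuniCoef.

(** View [p] as a polynomial in its last variable. Some coefficient is nonzero; induction gives grid
    values of the other variables at which it stays nonzero, and [poly_grid] then chooses the last
    value. *)
Lemma mpoly_grid (K : numFieldType) (n d : nat) (p : {mpoly K[n]}) : p != 0 ->
    (forall m, m \in msupp p -> forall i, (m i < d)%N) ->
  exists2 a : 'I_n -> nat, (forall i, (a i < d)%N) & p.@[fun i => (a i)%:R] != 0.
Proof.
elim: n p => [|n IH] p p0 pd.
  exists (fun=> 0%N); first by case.
  apply: contraNneq p0 => pv; apply/eqP/mpolyP => m.
  rewrite mcoeff0 -[RHS]pv [in RHS](mpolyE p) raddf_sum /=.
  rewrite [in LHS](mpolyE p) raddf_sum /=; apply: eq_bigr => m' _.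
  rewrite mcoeffZ mevalZ mcoeffX mevalX big_ord0.
  by have -> : m' = m; [apply/mnmP; case | rewrite eqxx].
have [m0 m0p] : exists m, m \in msupp p.
  by case E: (msupp p) => [|m s]; [move: p0; rewrite -msupp_eq0 E | exists m; rewrite mem_head].
set j := m0 ord_max; have qc := muni_coef p.
pose q := (muni p)`_j.
have q0 : q != 0.
  apply: contraTneq m0p => q0; rewrite mcoeff_msupp -qc -/j -/q q0 mcoeff0 eqxx //.
have lift_m k (m : 'X_{1..n}) : (muni p)`_k@_m != 0 -> exists2 m', m' \in msupp p &
    (forall i, m i = m' (widen_ord (leqnSn n) i)) /\ m' ord_max = k.
  move=> mk; pose m' : 'X_{1..n.+1} := [multinom if unlift ord_max i is Some i' then m i' else k | i < n.+1].
  have m'w i : m' (widen_ord (leqnSn n) i) = m i.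
    by rewrite mnmE -lift_max_widen liftK.
  have m'max : m' ord_max = k by rewrite mnmE unlift_none.
  exists m'; last by split=> // i; rewrite m'w.
  rewrite mcoeff_msupp -qc m'max.
  rewrite (_ : [multinom _ | i < n] = m) //.
  by apply/mnmP => i; rewrite mnmE m'w.
have [|a ad qa] := IH q q0.
  by move=> m; rewrite mcoeff_msupp => /lift_m[m' m'p [mm' _]] i; rewrite mm'; apply: pd.
have [||b bd Pb] := @poly_grid K (map_poly (meval (fun i => (a i)%:R)) (muni p)) d.
- by apply: contraNneq qa => P0; rewrite /q -coef_map P0 coef0.
- apply/leq_sizeP => k dk; rewrite coef_map /=.
  suff -> : (muni p)`_k = 0 by rewrite meval0.
  apply/mpolyP => m; rewrite mcoeff0; apply: contrapT => /eqP /lift_m [m' m'p [_ m'k]].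
  by have := pd m' m'p ord_max; lia.
pose a' i := if unlift ord_max i is Some i' then a i' else b.
exists a' => [i|]; first by rewrite /a'; case: unlift.
rewrite muni_eval /= /a' unlift_none.
rewrite (_ : map_poly _ _ = map_poly (meval (fun i => (a i)%:R)) (muni p)) //.
apply: eq_map_poly => r; apply: meval_eq => i /=.
by rewrite -lift_max_widen liftK.
Qed.

(** * A modulus not dividing a given number *)

(* The entries [L n k] of Leibniz's harmonic triangle are the inverses of
   [n.+1 * 'C(n, k)] and satisfy [L n.+1 k.+1 = L n k - L n.+1 k]. *)
Lemma leibniz_triangle (D n k : nat) : (k <= n)%N ->
  (forall d, (0 < d <= n.+1)%N -> (d %| D)%N) -> (n.+1 * 'C(n, k) %| D)%N.
Proof.
elim: k n => [|k IH] n kn Dd; first by rewrite bin0 muln1; apply: Dd; lia.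
case: n kn Dd => [//|m] kn Dd.
set E := (_ * _)%N.
pose A := (m.+1 * 'C(m, k))%N; pose B := (m.+2 * 'C(m.+1, k))%N.
have /dvdnP[x Dx] : (A %| D)%N by apply: IH => // d /andP[d0 dm]; apply: Dd; lia.
have /dvdnP[y Dy] : (B %| D)%N by apply: IH => //; lia.
have ABE : (A * (E + B) = E * B)%N.
  rewrite /E /B -mulnDr -binS [in LHS]/A mul_bin_diag.
  rewrite [(m.+2 * 'C(m.+1, k))%N]mul_bin_diag; nia.
have A0 : (0 < A)%N by rewrite /A muln_gt0 /= bin_gt0; lia.
have B0 : (0 < B)%N by rewrite /B muln_gt0 /= bin_gt0; lia.
have ED : (E * x = D + E * y)%N.
  have AB0 : (0 < A * B)%N by nia.
  apply/eqP; rewrite -(eqn_pmul2l AB0); apply/eqP.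
  have -> : (A * B * (E * x) = (E * B) * (x * A))%N by nia.
  rewrite -ABE -Dx [RHS]mulnDr.
  have -> : (A * B * (E * y) = A * E * (y * B))%N by nia.
  by rewrite -Dy; nia.
by apply/dvdnP; exists (x - y)%N; rewrite mulnC mulnBr ED addnK.
Qed.

Lemma exp2_le_central_bin M : (2 ^ M <= 'C(M.*2, M))%N.
Proof.
elim: M => [//|M IH]; rewrite doubleS binS expnS mul2n -addnn.
apply: leq_add; first by rewrite binS; lia.
by apply: leq_trans IH _; apply: leq_bin2l.
Qed.

(** If every [d] up to [2M + 1] divided [v], so would [2M + 1] times the central binomial
    coefficient ['C(2M, M)], which is at least [2 ^ M] and hence too large. *)
Lemma exists_nondivisor (v M : nat) : (0 < v < 2 ^ M)%N ->
  exists2 d, (1 < d <= M.*2.+1)%N & ~~ (d %| v)%N.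
Proof.
move=> /andP[v0 vM]; apply: contrapT => no_d.
have /(dvdn_leq v0) : (M.*2.+1 * 'C(M.*2, M) %| v)%N.
  apply: leibniz_triangle => [|d /andP[d0 dM]]; first by lia.
  have [->|d1] := eqVneq d 1%N; first exact: dvd1n.
  apply/negPn/negP => dv; apply: no_d; exists d => //; lia.
by have := exp2_le_central_bin M; nia.
Qed.

(** * Invariants of the tensor action *)

Lemma mnm_le_mdeg n (m : 'X_{1..n}) i : (m i <= mdeg m)%N.
Proof. by rewrite mdegE (bigD1 i) //= leq_addr. Qed.

Lemma mpoly_grid_msize (K : numFieldType) (n : nat) (p : {mpoly K[n]}) : p != 0 ->
  exists2 a : 'I_n -> nat, (forall i, (a i < msize p)%N) & p.@[fun i => (a i)%:R] != 0.
Proof.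
move=> /mpoly_grid; apply=> m mp i.
exact: leq_ltn_trans (mnm_le_mdeg m i) (msize_mdeg_lt mp).
Qed.

Lemma mpoly_eval_eq0 (K : numFieldType) (n : nat) (p : {mpoly K[n]}) :
  (forall v, p.@[v] = 0) -> p = 0.
Proof.
move=> pv; apply: contrapT => /eqP /mpoly_grid_msize [a _].
by rewrite pv eqxx.
Qed.

(** Scaling the variables by [w] multiplies each monomial by its value at [w]. Polynomials that
    agree as functions have equal coefficients, which forces this value to be 1 on the support. *)
Lemma diag_invariant_weight (K : numFieldType) (n : nat) (w : 'I_n -> K)
    (f : {mpoly K[n]}) : (forall v, f.@[fun l => w l * v l] = f.@[v]) ->
  forall m, m \in msupp f -> \prod_l w l ^+ m l = 1.
Proof.
move=> fw m mf.
pose c m' := f@_m' * (\prod_l w l ^+ m' l - 1).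
have h0 : \sum_(m' <- msupp f) c m' *: 'X_[m'] = 0 :> {mpoly K[n]}.
  apply: mpoly_eval_eq0 => v; rewrite raddf_sum /=.
  transitivity (f.@[fun l => w l * v l] - f.@[v]); last by rewrite fw subrr.
  rewrite !mevalE -sumrB; apply: eq_bigr => m' _.
  rewrite mevalZ mevalX /c -mulrA -mulrBr; congr (_ * _).
  rewrite mulrBl mul1r -big_split /=; congr (_ - _).
  by apply: eq_bigr => i _; rewrite exprMn.
have : c m = 0.
  have := congr1 (mcoeff m) h0; rewrite mcoeff0 raddf_sum /=.
  rewrite (bigD1_seq m) ?msupp_uniq //= big1 ?addr0 => [|m' m'm].
    by rewrite mcoeffZ mcoeffX eqxx mulr1.
  by rewrite mcoeffZ mcoeffX (negPf m'm) mulr0.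
move/eqP; rewrite mulf_eq0 subr_eq0 => /orP[|/eqP //].
by rewrite mcoeff_eq0 mf.
Qed.

Section TensorInvariants.

Variables (K : numFieldType) (n : nat).

Local Notation dim := (tensor_dim n).

Definition st_one : ST K n.
Proof.
by apply: (@MkST K n (fun=> 1)) => [i|]; rewrite ?oner_eq0 // big1.
Defined.

(** For [i != j] the entries 2 and 1/2 have product 1. Distinct powers of 2 differ, so invariance
    under this single element equates the marginals at [i] and [j]. *)
Definition st_pair_fun (i j k : 'I_n) : K :=
  if k == i then 2 else if k == j then 2^-1 else 1.

Lemma st_pair_neq0 i j k : st_pair_fun i j k != 0.
Proof.
by rewrite /st_pair_fun; case: ifP => _; [|case: ifP => _]; rewrite ?oner_eq0 ?invr_eq0 ?pnatr_eq0.
Qed.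

Lemma st_pair_prod i j (e : 'I_n -> nat) : i != j ->
  \prod_k st_pair_fun i j k ^+ e k = 2 ^+ e i / 2 ^+ e j.
Proof.
move=> ij; rewrite (bigD1 i) //= (bigD1 j) 1?eq_sym //= big1 => [|k /andP[ki kj]].
  by rewrite mulr1 /st_pair_fun !eqxx eq_sym (negPf ij) exprVn.
by rewrite /st_pair_fun (negPf ki) (negPf kj) expr1n.
Qed.

Definition st_pair (i j : 'I_n) (ij : i != j) : ST K n.
Proof.
apply: (@MkST K n (st_pair_fun i j)) => [k|]; first exact: st_pair_neq0.
have := st_pair_prod (fun=> 1%N) ij.
by rewrite divff ?expf_neq0 ?pnatr_eq0 // => <-; apply: eq_bigr => k _; rewrite expr1.
Defined.

Definition marginal (pr : 'I_dim -> 'I_n) (m : 'X_{1..dim}) (i : 'I_n) : nat :=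
  \sum_(l | pr l == i) m l.

Definition coord1 (l : 'I_dim) : 'I_n := (enum_val l).1.1.
Definition coord2 (l : 'I_dim) : 'I_n := (enum_val l).1.2.
Definition coord3 (l : 'I_dim) : 'I_n := (enum_val l).2.

Lemma sum_marginal pr m : (\sum_i marginal pr m i)%N = mdeg m.
Proof.
by rewrite mdegE (partition_big pr xpredT).
Qed.

Lemma marginal_eq pr (m : 'X_{1..dim}) :
  (forall a : ST K n, \prod_l a (pr l) ^+ m l = 1) ->
  forall i j, marginal pr m i = marginal pr m j.
Proof.
move=> am i j; have [->//|ij] := eqVneq i j.
have := am (st_pair ij).
rewrite (partition_big pr xpredT) //=.
rewrite (eq_bigr (fun k => st_pair_fun i j k ^+ marginal pr m k)); last first.
  move=> k _; rewrite (eq_bigr (fun l => st_pair_fun i j k ^+ m l)).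
    by rewrite -expr_sum.
  by move=> l /eqP ->.
rewrite st_pair_prod // => /divr1_eq /eqP.
by rewrite -!natrX eqr_nat eqn_exp2l // => /eqP.
Qed.


Lemma invariant_marginal f m : Defs.invariant (@tensor_act K n) f ->
    m \in msupp f ->
  [/\ forall i j, marginal coord1 m i = marginal coord1 m j,
      forall i j, marginal coord2 m i = marginal coord2 m j &
      forall i j, marginal coord3 m i = marginal coord3 m j].
Proof.
move=> finv mf.
have wP (a b c : ST K n) :
    \prod_l (a (coord1 l) * b (coord2 l) * c (coord3 l)) ^+ m l = 1.
  apply: (diag_invariant_weight _ mf) => v; rewrite -[RHS](finv (a, b, c)).
  by apply: meval_eq => l; rewrite /tensor_act /coord1 /coord2 /coord3; case: enum_val => [[]].
split; apply: marginal_eq => a.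
- rewrite -[RHS](wP a st_one st_one); apply: eq_bigr => l _; by rewrite /= !mulr1.
- rewrite -[RHS](wP st_one a st_one); apply: eq_bigr => l _; by rewrite /= mulr1 mul1r.
- rewrite -[RHS](wP st_one st_one a); apply: eq_bigr => l _; by rewrite /= !mul1r.
Qed.

(** Consequently the degree of an invariant monomial is a multiple of [n], and in degree [n] all
    marginals are 1. *)
Lemma marginal_mdeg pr (m : 'X_{1..dim}) :
  (forall i j, marginal pr m i = marginal pr m j) ->
  forall i, mdeg m = (n * marginal pr m i)%N.
Proof.
move=> me i; rewrite -(sum_marginal pr) (eq_bigr (fun=> marginal pr m i)) //.
by rewrite sum_nat_const card_ord.
Qed.

Lemma marginal_gt0 pr (m : 'X_{1..dim}) i : (0 < marginal pr m i)%N ->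
  exists2 l, pr l = i & (0 < m l)%N.
Proof.
rewrite lt0n sum_nat_eq0 => /forallPn[l]; rewrite negb_imply => /andP[/eqP prl ml].
by exists l; rewrite ?lt0n.
Qed.

Lemma marginal_le1 pr (m : 'X_{1..dim}) i l l' : (marginal pr m i <= 1)%N ->
  pr l = i -> pr l' = i -> (0 < m l)%N -> (0 < m l')%N -> l = l'.
Proof.
move=> m1 li l'i ml ml'; apply/eqP; apply: contraTT m1 => ll'.
rewrite /marginal (bigD1 l) ?li //= (bigD1 l') /=; last by rewrite l'i eqxx eq_sym.
lia.
Qed.

Definition tensor_subset (S : 'I_dim -> bool) (x y z : 'I_n) : bool :=
  S (enum_rank (x, y, z)).

Lemma marginal1_matching (m : 'X_{1..dim}) (S : 'I_dim -> bool) :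
  (forall i, marginal coord1 m i = 1%N) ->
  (forall i, marginal coord2 m i = 1%N) ->
  (forall i, marginal coord3 m i = 1%N) ->
  (forall l, (0 < m l)%N -> S l) -> perfect_matching (tensor_subset S).
Proof.
move=> m1 m2 m3 mS.
have /choice[L LP] (y : 'I_n) : exists l, coord2 l = y /\ (0 < m l)%N.
  by have [|l] := @marginal_gt0 coord2 m y; [rewrite m2 | exists l].
have Linj pr : (forall i, marginal pr m i = 1%N) -> injective (pr \o L).
  move=> mpr y y' /= prE.
  have [cy my] := LP y; have [cy' my'] := LP y'.
  have /(congr1 coord2) : L y = L y'.
    by apply: (@marginal_le1 pr m (pr (L y))) => //; rewrite mpr.
  by rewrite cy cy'.
exists (coord1 \o L), (coord3 \o L); split; [exact: Linj | exact: Linj |].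
move=> y; apply: mS; have [cy my] := LP y.
rewrite /= -{2}cy /coord1 /coord2 /coord3.
by case E: (enum_val (L y)) => [[a b] c] /=; rewrite -E enum_valK.
Qed.

(** Restriction to the line through the indicator vector of [S]: the coefficient of [t^d] is the
    value at that vector of the homogeneous part of degree [d]. *)
Definition restrict_line (S : 'I_dim -> bool) : {mpoly K[dim]} -> {poly K} :=
  mmap polyC (fun l => (S l)%:R *: 'X).

HB.instance Definition _ S := GRing.RMorphism.on (restrict_line S).

Lemma restrict_line_mnm (S : 'I_dim -> bool) (m : 'X_{1..dim}) :
  mmap1 (fun l => (S l)%:R *: 'X) m =
  ([forall l, (0 < m l)%N ==> S l])%:R *: 'X^(mdeg m) :> {poly K}.
Proof.
have -> : mmap1 (fun l => (S l)%:R *: 'X) m =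
    (\prod_l (S l)%:R ^+ m l) *: 'X^(mdeg m) :> {poly K}.
  rewrite mdegE expr_sum -mul_polyC rmorph_prod /= -big_split /=.
  by apply: eq_bigr => l _; rewrite -mul_polyC exprMn rmorphXn.
congr (_ *: _); case: forallP => [mS|nS].
  apply: big1 => l _; have := mS l; case: (S l); first by rewrite expr1n.
  by rewrite implybF -eqn0Ngt => /eqP ->.
have [l] : exists l, ~~ ((0 < m l)%N ==> S l) by apply/existsP; rewrite -negb_forall; apply/negP => /forallP.
rewrite negb_imply => /andP[ml Sl].
by rewrite (bigD1 l) //= (negPf Sl) expr0n -[m l == _]negbK -lt0n ml mul0r.
Qed.

Lemma restrict_line_coef (S : 'I_dim -> bool) (f : {mpoly K[dim]}) d :
  (restrict_line S f)`_d =
  \sum_(m <- msupp f | (mdeg m == d) && [forall l, (0 < m l)%N ==> S l]) f@_m.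
Proof.
rewrite /restrict_line /mmap coef_sum [RHS]big_mkcond /=; apply: eq_bigr => m _.
rewrite restrict_line_mnm coefCM coefZ coefXn eq_sym.
by case: eqP => _; case: forallP => _; rewrite ?mulr1 ?mulr0 ?mul0r ?mulr0.
Qed.

Lemma restrict_line_low S f d : Defs.invariant (@tensor_act K n) f ->
  (0 < d < n)%N -> (restrict_line S f)`_d = 0.
Proof.
move=> finv /andP[d0 dn]; rewrite restrict_line_coef big_seq_cond big1 // => m.
case/and3P=> mf /eqP md _; have [m1 _ _] := invariant_marginal finv mf.
have n0 : (0 < n)%N by lia.
have := marginal_mdeg m1 (Ordinal n0); rewrite md => dE.
by exfalso; move: d0 dn; rewrite dE; case: (marginal _ _ _) => [|k]; lia.
Qed.

Lemma restrict_line_matching S f : (0 < n)%N -> Defs.invariant (@tensor_act K n) f ->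
  (restrict_line S f)`_n != 0 -> perfect_matching (tensor_subset S).
Proof.
move=> n0 finv; rewrite restrict_line_coef => fn.
have [m /and3P[mf /eqP md /forallP mS]] : exists m,
   [&& m \in msupp f, mdeg m == n & [forall l, (0 < m l)%N ==> S l]].
  apply: contrapT => no_m; case/eqP: fn; rewrite big_seq_cond big1 // => m mP.
  by case: no_m; exists m.
have one pr : (forall i j, marginal pr m i = marginal pr m j) ->
    forall i, marginal pr m i = 1%N.
  move=> mpr i; have := marginal_mdeg mpr i; rewrite md => /eqP.
  by rewrite -{1}[n]muln1 eqn_pmul2l // => /eqP.
have [m1 m2 m3] := invariant_marginal finv mf.
apply: (@marginal1_matching m); [exact: one|exact: one|exact: one|].
by move=> l ml; apply: (implyP (mS l)).
Qed.

(** The product of the variables of the matching is scaled by a product of three determinants,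
    because [s] and [t] permute the indices. *)
Lemma matching_monomial S : perfect_matching (tensor_subset S) ->
  exists2 f, Defs.invariant (@tensor_act K n) f & restrict_line S f = 'X^n.
Proof.
case=> s [t [s_inj t_inj stS]].
exists (\prod_y 'X_(enum_rank (s y, y, t y))).
  move=> [[a b] c] v; rewrite !rmorph_prod /=.
  under eq_bigr do rewrite mevalXU /tensor_act enum_rankK.
  under [RHS]eq_bigr do rewrite mevalXU.
  rewrite !big_split /= -[RHS]mul1r; congr (_ * _).
  have -> : \prod_y a (s y) = 1.
    by rewrite -[RHS](st_det1 a) [RHS](reindex_inj s_inj).
  have -> : \prod_y c (t y) = 1.
    by rewrite -[RHS](st_det1 c) [RHS](reindex_inj t_inj).
  by rewrite (st_det1 b) !mulr1.
rewrite rmorph_prod /= (eq_bigr (fun=> 'X)).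
  by rewrite prodr_const card_ord.
move=> y _; rewrite /restrict_line mmapX mmap1U.
by have := stS y; rewrite /tensor_subset => ->; rewrite scale1r.
Qed.

End TensorInvariants.

(** * Generators detect perfect matchings *)

Definition flat_upto (R : nzRingType) (n : nat) (p : {poly R}) : Prop :=
  forall d, (0 < d <= n)%N -> p`_d = 0.

Section Flat.

Variables (R : comNzRingType) (n : nat).
Implicit Types p q : {poly R}.

Lemma flat_uptoC c : flat_upto n (c%:P : {poly R}).
Proof. by move=> d /andP[d0 _]; rewrite coefC; case: d d0. Qed.

Lemma flat_uptoD p q : flat_upto n p -> flat_upto n q -> flat_upto n (p + q).
Proof. by move=> hp hq d dn; rewrite coefD hp // hq // addr0. Qed.

(** Flat polynomials are those that are constant modulo [t^(n+1)], so they form a subring containing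
    the constants. *)
Lemma flat_uptoM p q : flat_upto n p -> flat_upto n q -> flat_upto n (p * q).
Proof.
move=> hp hq d dn; rewrite coefM big1 // => i _.
have [i0|i0] := posnP i; last by rewrite hp ?mul0r //; have := ltn_ord i; lia.
by rewrite i0 subn0 (hq d) // mulr0.
Qed.

Lemma flat_uptoX p k : flat_upto n p -> flat_upto n (p ^+ k).
Proof.
move=> hp; elim: k => [|k IH]; first by rewrite expr0; apply: (flat_uptoC 1).
by rewrite exprS; apply: flat_uptoM.
Qed.

End Flat.

(* The degree-[n] parts of the generators must span the degree-[n] invariants,
   that is, the matching monomials: if they all vanished at the indicator of
   [S], the generated algebra would be flat up to degree [n] on that line. *)
Lemma encoding_matching (K : numFieldType) (n r : nat) (c : acircuit (tensor_dim n) r)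
    (S : 'I_(tensor_dim n) -> bool) :
  (0 < n)%N -> succinctly_encodes (@tensor_act K n) c ->
  perfect_matching (tensor_subset S) <->
  exists alpha : 'I_r -> K, (restrict_line S (acircuit_poly c alpha))`_n != 0.
Proof.
move=> n0 enc.
have cinv alpha : Defs.invariant (@tensor_act K n) (acircuit_poly c alpha).
  apply/enc; exists 1%N, [tuple acircuit_poly c alpha], 'X_ord0; split.
    by move=> i; exists alpha; rewrite ord1.
  by rewrite comp_mpolyXU.
split=> [|[alpha ca]]; last exact: restrict_line_matching (cinv alpha) ca.
move=> /(matching_monomial K) [f /enc [k [s [P [sP fE]]]] fX].
apply: contrapT => no_alpha.
have flat_s i : flat_upto n (restrict_line S (tnth s i)).
  have [alpha ->] := sP i; move=> d /andP[d0]; rewrite leq_eqVlt => /orP[/eqP->|dn].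
    by apply: contrapT => /eqP ca; apply: no_alpha; exists alpha.
  by apply: restrict_line_low; rewrite ?d0.
have : flat_upto n (restrict_line S f).
  rewrite fE comp_mpolyE rmorph_sum /=.
  elim/big_rec: _ => [|m p _ hp]; first by rewrite -polyC0; apply: flat_uptoC.
  apply: flat_uptoD hp; rewrite -mul_mpolyC rmorphM /=.
  rewrite /restrict_line mmapC -/(restrict_line S); apply: flat_uptoM; first exact: flat_uptoC.
  rewrite rmorph_prod /=; elim/big_rec: _ => [|i q _ hq]; first by rewrite -polyC1; apply: flat_uptoC.
  by apply: flat_uptoM hq; rewrite rmorphXn /=; apply: flat_uptoX.
move/(_ n); rewrite n0 leqnn fX coefXn eqxx => /(_ erefl)/eqP.
by rewrite oner_eq0.
Qed.

(** * Evaluating circuits in several rings *)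

Section GateValues.

Variables (gate : Type) (args : gate -> seq nat).

Lemma topological_rcons i gs g : topological args i (rcons gs g) =
  topological args i gs && all (fun j => (j < i + size gs)%N) (args g).
Proof.
elim: gs i => [|h gs IH] i /=; first by rewrite addn0 andbT.
by rewrite IH -andbA addSnnS.
Qed.

Lemma gate_values_rcons T (step : seq T -> gate -> T) gs g :
  gate_values step (rcons gs g) =
  rcons (gate_values step gs) (step (gate_values step gs) g).
Proof. by rewrite /gate_values -cats1 foldl_cat. Qed.

Lemma size_gate_values T (step : seq T -> gate -> T) gs :
  size (gate_values step gs) = size gs.
Proof.
by elim/last_ind: gs => [//|gs g IH]; rewrite gate_values_rcons !size_rcons IH.
Qed.

(** Induction along one circuit evaluated in two ways. The relation depends on the gate number, so
    that bounds may grow along the circuit; a second evaluation in [unit] turns it into a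
    predicate. *)
Lemma gate_values_rel T1 T2 (step1 : seq T1 -> gate -> T1)
    (step2 : seq T2 -> gate -> T2) (d1 : T1) (d2 : T2)
    (rel : nat -> T1 -> T2 -> Prop) (gs : seq gate) :
  (forall vs1 vs2 g, List.In g gs ->
     (forall j, (j < size vs1)%N -> rel j (nth d1 vs1 j) (nth d2 vs2 j)) ->
     all (fun j => (j < size vs1)%N) (args g) ->
     rel (size vs1) (step1 vs1 g) (step2 vs2 g)) ->
  topological args 0 gs ->
  forall i, (i < size gs)%N ->
    rel i (nth d1 (gate_values step1 gs) i) (nth d2 (gate_values step2 gs) i).
Proof.
elim/last_ind: gs => [//|gs g IH] stepP.
rewrite topological_rcons => /andP[/IH {}IH gi] i.
have {}IH : forall i, (i < size gs)%N ->
    rel i (nth d1 (gate_values step1 gs) i) (nth d2 (gate_values step2 gs) i).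
  apply: IH => vs1 vs2 h hgs; apply: stepP.
  by rewrite -cats1; apply/List.in_or_app; left.
rewrite size_rcons ltnS !gate_values_rcons !nth_rcons !size_gate_values.
rewrite leq_eqVlt => /orP[/eqP->|ilt]; last by rewrite ilt; apply: IH.
rewrite ltnn eqxx.
rewrite -[X in rel X](size_gate_values step1); apply: stepP; rewrite ?size_gate_values //.
by rewrite -cats1; apply/List.in_or_app; right; left.
Qed.

End GateValues.

Lemma acircuit_ok m r (c : acircuit m r) :
  topological (@agate_args m r) 0 (agates c) /\ (aoutput c < size (agates c))%N.
Proof. by case: c => gs o /= /andP. Qed.

Lemma acircuit_eval_rmorph m r (c : acircuit m r) (A B : nzRingType)
    (f : {rmorphism A -> B}) cst x y cst' x' y' :
  (forall q, f (cst q) = cst' q) -> (forall i, f (x i) = x' i) ->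
  (forall j, f (y j) = y' j) ->
  f (acircuit_eval cst x y c) = acircuit_eval cst' x' y' c.
Proof.
move=> fc fx fy; have [topo out] := acircuit_ok c.
apply: (gate_values_rel (rel := fun _ a b => f a = b) (d1 := 0) (d2 := 0) _ topo out).
move=> vs1 vs2 [i|j|q|i j|i j] _ IH //= /and3P[iv jv _].
  by rewrite rmorphD /= !IH.
by rewrite rmorphM /= !IH.
Qed.

Definition line_eval m r (K : fieldType) (S : 'I_m -> bool) (alpha : 'I_r -> K) :=
  acircuit_eval (fun q => (ratr q)%:P) (fun l => (S l)%:R *: 'X : {poly K})
    (fun j => (alpha j)%:P).

Lemma restrict_line_eval (K : numFieldType) n r (c : acircuit (tensor_dim n) r) S
    (alpha : 'I_r -> K) :
  restrict_line S (acircuit_poly c alpha) = line_eval S alpha c.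
Proof.
apply: (@acircuit_eval_rmorph _ _ c _ _ (restrict_line S)) => [q|l|j] /=; rewrite /restrict_line ?mmapC //.
by rewrite mmapX mmap1U.
Qed.

(** * Integer parameters that serve all sets *)

Section GenericPoint.

Variables (K : numFieldType) (m r : nat) (c : acircuit m r) (S : 'I_m -> bool).

(** The parameters are kept as indeterminates, so that a coefficient for all [alpha] at once is a
    single polynomial, to which the grid argument applies. *)
Definition generic_eval : {poly {mpoly K[r]}} :=
  acircuit_eval (fun q => (ratr q)%:MP%:P) (fun l => (S l)%:R *: 'X)
    (fun j => ('X_j)%:P) c.

Lemma generic_evalE alpha k : (generic_eval`_k).@[alpha] = (line_eval S alpha c)`_k.
Proof.
suff <- : map_poly (meval alpha) generic_eval = line_eval S alpha c by rewrite coef_map.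
apply: (@acircuit_eval_rmorph _ _ c _ _ (map_poly (meval alpha))) => [q|l|j].
- by rewrite /= map_polyC /= mevalC.
- by rewrite /= map_polyZ /= map_polyX rmorph_nat.
- by rewrite /= map_polyC /= mevalXU.
Qed.

Lemma msizeD_le_leq (p q : {mpoly K[r]}) d : (msize p <= d)%N -> (msize q <= d)%N ->
  (msize (p + q) <= d)%N.
Proof. by move=> pd qd; apply: leq_trans (msizeD_le _ _) _; rewrite geq_max pd qd. Qed.

(** A multiplication adds two degrees, each at most the bound for earlier gates, so gate [i] has
    degree at most [2 ^ i] in the parameters; [msize] exceeds the degree by one. *)
Lemma msize_generic_eval k : (msize (generic_eval`_k) <= (2 ^ size (agates c)).+1)%N.
Proof.
have [topo out] := acircuit_ok c.
have : forall k, (msize (generic_eval`_k) <= (2 ^ aoutput c).+1)%N; last first.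
  move/(_ k)/leq_trans; apply; rewrite ltnS leq_exp2l //; lia.
apply: (gate_values_rel (rel := fun i (p : {poly {mpoly K[r]}}) (_ : unit) =>
  forall k, (msize (p`_k) <= (2 ^ i).+1)%N) (step2 := fun _ _ => tt) (d1 := 0) (d2 := tt) _ topo out).
move=> vs1 _ g _ IH /=.
have pos i : (0 < 2 ^ i)%N by rewrite expn_gt0.
case: g => [i|j|q|i j|i j] /=.
- move=> _ l; rewrite coefZ coefX; case: (S i); case: (l == _) => /=;
    by rewrite ?mulr0 ?mul0r ?mulr1 ?msize0 ?msize1.
- move=> _ l; rewrite coefC; case: (l == _); rewrite ?msize0 // msizeX mdeg1.
  by rewrite ltnS.
- move=> _ l; rewrite coefC; case: (l == _); rewrite ?msize0 //.
  by rewrite msizeC; case: (_ != _).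
- case/and3P=> iv jv _ l; rewrite coefD.
  apply: msizeD_le_leq; [apply: leq_trans (IH i iv l) _|apply: leq_trans (IH j jv l) _];
    by rewrite ltnS leq_exp2l // ltnW.
- case/and3P=> iv jv _ l; rewrite coefM.
  elim/big_rec: _ => [|a p _ hp]; first by rewrite msize0.
  apply: msizeD_le_leq hp.
  have [->|p0] := eqVneq vs1`_i`_a 0; first by rewrite mul0r msize0.
  have [->|q0] := eqVneq vs1`_j`_(l - a) 0; first by rewrite mulr0 msize0.
  rewrite msizeM //.
  have h1 := IH i iv a; have h2 := IH j jv (l - a)%N.
  move: iv jv; set s := size vs1 => iv jv.
  have h3 : (2 ^ i <= 2 ^ s.-1)%N by rewrite leq_exp2l //; move: iv; clearbody s; clear; lia.
  have h4 : (2 ^ j <= 2 ^ s.-1)%N by rewrite leq_exp2l //; move: jv; clearbody s; clear; lia.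
  have -> : s = s.-1.+1 by move: jv; clearbody s; clear; lia.
  have arith x y u v P : (x <= u.+1 -> y <= v.+1 -> u <= P -> v <= P ->
    (x + y).-1 <= (2 * P).+1)%N by clear; lia.
  by rewrite expnS /=; apply: arith h1 h2 h3 h4.
Qed.

End GenericPoint.

Lemma msize_prod_le (K : numFieldType) (I : Type) (s : seq I) r (P : pred I)
    (F : I -> {mpoly K[r]}) d :
  (forall i, (msize (F i) <= d.+1)%N) ->
  (msize (\prod_(i <- s | P i) F i) <= (size s * d).+1)%N.
Proof.
move=> Fd; elim: s => [|i s IH]; first by rewrite big_nil msize1.
rewrite big_cons; case: ifP => _; last first.
  by apply: leq_trans IH _; rewrite ltnS /= mulSn leq_addl.
set q := \prod_(_ <- _ | _) _ in IH *.
have [->|p0] := eqVneq (F i) 0; first by rewrite mul0r msize0.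
have [->|q0] := eqVneq q 0; first by rewrite mulr0 msize0.
rewrite msizeM //= mulSn; have := leq_add (Fd i) IH.
have arith x y : (x <= d.+1 + y.+1 -> x.-1 <= (d + y).+1)%N by clear; lia.
exact: arith.
Qed.

(* A single point works for all the sets [S] at once, because the product of
   the corresponding nonzero polynomials is nonzero. *)
Lemma common_point (K : numFieldType) m r (c : acircuit m r) (n : nat) :
  exists2 a : 'I_r -> nat,
    forall j, (a j < (2 ^ m * 2 ^ size (agates c)).+1)%N &
    forall (S : {ffun 'I_m -> bool}) (alpha : 'I_r -> K),
      (line_eval S alpha c)`_n != 0 ->
      (line_eval S (fun j => (a j)%:R : K) c)`_n != 0.
Proof.
pose G S := (generic_eval K c S)`_n.
pose P := \prod_(S <- enum {ffun 'I_m -> bool} | G (fun_of_fin S) != 0) G S.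
have P0 : P != 0 by rewrite prodf_seq_neq0; apply/allP => S _; apply/implyP.
have [a aP Pa] := mpoly_grid_msize P0.
exists a => [j|S alpha].
  (* The product [P] has at most [2 ^ m] factors, each of degree at most [2 ^ size (agates c)]. *)
  apply: leq_trans (aP j) _; rewrite /P.
  apply: leq_trans (msize_prod_le (d := 2 ^ size (agates c)) _ _ _) _.
    by move=> S; apply: msize_generic_eval.
  by rewrite -cardE card_ffun card_bool card_ord.
rewrite -!generic_evalE => Sa.
have GS : G (fun_of_fin S) != 0 by apply: contraNneq Sa; rewrite /G => ->; rewrite meval0.
move: Pa; rewrite /P rmorph_prod /= prodf_seq_neq0 => /allP/(_ S).
by rewrite mem_enum => /(_ isT)/implyP/(_ GS).
Qed.

(** * Clearing denominators *)

Lemma absz_add_le (u v : int) : (absz (u + v)%R <= absz u + absz v)%N.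
Proof. lia. Qed.

Lemma absz_sum_le k (F : 'I_k -> int) B : (forall i, (absz (F i) <= B)%N) ->
  (absz (\sum_i F i)%R <= k * B)%N.
Proof.
elim: k F => [|k IH] F FB; first by rewrite big_ord0.
rewrite big_ord_recr /= mulSnr; apply: leq_trans (absz_add_le _ _) _.
exact: leq_add (IH _ (fun i => FB _)) (FB _).
Qed.

Section FractionStep.

Variables (A : comNzRingType) (m r : nat).
Variables (x : 'I_m -> {poly A}) (y : 'I_r -> A).

(* The pair [(p, d)] stands for the fraction [p / d]. *)
Definition frac_step (vs : seq ({poly A} * A)) (g : agate m r) : {poly A} * A :=
  let v i := nth (0, 1) vs i in
  match g with
  | AX l => (x l, 1)
  | AY j => ((y j)%:P, 1)
  | AConst q => ((numq q)%:~R%:P, (denq q)%:~R)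
  | AAdd i j => ((v j).2 *: (v i).1 + (v i).2 *: (v j).1, (v i).2 * (v j).2)
  | AMul i j => ((v i).1 * (v j).1, (v i).2 * (v j).2)
  end.

Definition frac_output (c : acircuit m r) : {poly A} * A :=
  nth (0, 1) (gate_values frac_step (agates c)) (aoutput c).

Definition frac_eval (c : acircuit m r) : {poly A} := (frac_output c).1.

End FractionStep.

Definition indic_line (A : comNzRingType) m (S : 'I_m -> bool) : 'I_m -> {poly A} :=
  fun l => (S l)%:R *: 'X.

Section ClearDenominators.

Variables (m r : nat) (c : acircuit m r) (S : 'I_m -> bool) (a : 'I_r -> nat).

Definition int_eval : {poly int} :=
  frac_eval (indic_line int S) (fun j => (a j)%:R) c.

(** All denominators are nonzero integers, so [int_eval] is a nonzero constant multiple of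
    [line_eval]. *)
Lemma int_eval_neq0 (K : numFieldType) k :
  (int_eval`_k != 0) = ((line_eval S (fun j => (a j)%:R : K) c)`_k != 0).
Proof.
have [topo out] := acircuit_ok c.
suff [d d0 dE] : exists2 d : int, d != 0 & forall k,
    (int_eval`_k)%:~R = d%:~R * (line_eval S (fun j => (a j)%:R : K) c)`_k.
  by rewrite -(intr_eq0 K) dE mulf_eq0 intr_eq0 (negPf d0).
pose rel (i : nat) (u : {poly int} * int) (v : {poly K}) :=
  u.2 != 0 /\ map_poly intr u.1 = u.2%:~R *: v.
have [] : rel (aoutput c)
  (frac_output (indic_line int S) (fun j => (a j)%:R) c)
  (line_eval S (fun j => (a j)%:R : K) c).
  apply: (gate_values_rel (rel := rel) _ topo out).
  move=> vs1 vs2 [l|j|q|i j|i j] _ IH /=; rewrite /rel /=.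
  - by split=> //; rewrite /indic_line map_polyZ /= map_polyX scale1r rmorph_nat.
  - by split=> //; rewrite map_polyC /= rmorph_nat scale1r.
  - rewrite !intz; split; first exact: denq_neq0.
    rewrite map_polyC /= -mul_polyC -polyCM; congr (_%:P).
    by rewrite [ratr q]/ratr mulrC divfK // intr_eq0 denq_neq0.
  - move=> /and3P[/IH[d1 e1] /IH[d2 e2] _]; split; first by rewrite mulf_neq0.
    rewrite rmorphD /= !map_polyZ /= e1 e2 !scalerA rmorphM /=.
    by rewrite [X in X *: _ + _]mulrC -scalerDr.
  - move=> /and3P[/IH[d1 e1] /IH[d2 e2] _]; split; first by rewrite mulf_neq0.
    by rewrite rmorphM /= e1 e2 -scalerAl -scalerAr scalerA rmorphM.
move=> d0 dE; exists (frac_output (indic_line int S) (fun j => (a j)%:R) c).2 => // k'.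
by rewrite -coefZ -dE coef_map.
Qed.

(** If earlier numerators and denominators are at most [P], an addition yields at most [2 * P * P],
    and a multiplication at most [(k + 1) * P * P] in degree [k <= n]. Both are at most [P ^ 3], as
    [n < 2 ^ b <= P]; hence the exponent triples at each gate. *)
Lemma int_eval_bound n b : (0 < n < 2 ^ b)%N -> (0 < b)%N -> (forall j, a j <= 2 ^ b)%N ->
  (forall q, List.In (AConst m r q) (agates c) ->
     (absz (numq q) <= 2 ^ b)%N /\ (absz (denq q) <= 2 ^ b)%N) ->
  (absz (int_eval`_n)%R <= 2 ^ (b * 3 ^ size (agates c)))%N.
Proof.
move=> nb b0 ab cb; have [topo out] := acircuit_ok c.
pose rel (i : nat) (u : {poly int} * int) (v : unit) :=
  (absz u.2 <= 2 ^ (b * 3 ^ i))%N /\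
  forall k, (k <= n)%N -> (absz (u.1`_k)%R <= 2 ^ (b * 3 ^ i))%N.
suff [_ /(_ n (leqnn n))] : rel (aoutput c)
  (frac_output (indic_line int S) (fun j => (a j)%:R) c) tt.
  move/leq_trans; apply; rewrite leq_exp2l // leq_mul2l leq_exp2l // (ltnW out) orbT //.
apply: (gate_values_rel (rel := rel) (step2 := fun _ _ => tt) (d2 := tt) _ topo out).
move=> vs1 vs2 g gc IH; set s := size vs1; pose P := (2 ^ (b * 3 ^ s.-1))%N.
have bs i : (b <= b * 3 ^ i)%N by rewrite leq_pmulr // expn_gt0.
have B1 i : (2 ^ b <= 2 ^ (b * 3 ^ i))%N by rewrite leq_exp2l.
have one : (1 <= 2 ^ (b * 3 ^ s))%N by rewrite expn_gt0.
have powP i : (i < s)%N ->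
    [/\ (2 ^ (b * 3 ^ i) <= P)%N, (2 <= P)%N & (P * P * P <= 2 ^ (b * 3 ^ s))%N].
  move=> iv; split.
  - rewrite leq_exp2l // leq_mul2l leq_exp2l //; apply/orP; right.
    by move: iv; clearbody s; clear; lia.
  - by apply: leq_trans (B1 _); rewrite -[X in (X <= _)%N]expn1 leq_exp2l.
  - have -> : s = s.-1.+1 by move: iv; clearbody s; clear; lia.
    by rewrite expnS mulnCA [(3 * _)%N]mulnC expnM -/P !expnS expn0 muln1 mulnA.
case: g gc => [l|j|q|i j|i j] gc /=; rewrite /rel /=.
- move=> _; split=> // k kn; rewrite /indic_line coefZ coefX.
  by case: (S l); case: (k == _).
- move=> _; split=> // k kn; rewrite coefC; case: (k == _); last by [].
  rewrite natz /=; exact: leq_trans (ab j) (B1 s).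
- have [c1 c2] := cb q gc.
  move=> _; split=> [|k kn]; first by rewrite intz; apply: leq_trans c2 (B1 s).
  rewrite coefC; case: (k == _); last by [].
  by rewrite intz; apply: leq_trans c1 (B1 s).
- move=> /and3P[iv jv _]; have [di ci] := IH i iv; have [dj cj] := IH j jv.
  have [le_i two P3] := powP i iv; have [le_j _ _] := powP j jv.
  split=> [|k kn].
    rewrite abszM; apply: leq_trans P3; rewrite -[X in (X <= _)%N]mul1n mulnA.
    apply: leq_mul (leq_trans dj le_j); apply: leq_mul (leq_trans di le_i).
    by apply: leq_trans two.
  rewrite coefD !coefZ; apply: leq_trans (absz_add_le _ _) _; rewrite !abszM.
  apply: leq_trans P3; apply: leq_trans (leq_mul (leq_mul two (leqnn _)) (leqnn _)).
  rewrite -mulnA mul2n -addnn; apply: leq_add.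
    exact: leq_mul (leq_trans dj le_j) (leq_trans (ci k kn) le_i).
  exact: leq_mul (leq_trans di le_i) (leq_trans (cj k kn) le_j).
- move=> /and3P[iv jv _]; have [di ci] := IH i iv; have [dj cj] := IH j jv.
  have [le_i two P3] := powP i iv; have [le_j _ _] := powP j jv.
  split=> [|k kn].
    rewrite abszM; apply: leq_trans P3; rewrite -[X in (X <= _)%N]mul1n mulnA.
    apply: leq_mul (leq_trans dj le_j); apply: leq_mul (leq_trans di le_i).
    by apply: leq_trans two.
  rewrite coefM; apply: leq_trans P3.
  apply: leq_trans (absz_sum_le (B := P * P) _) _.
    move=> l; rewrite abszM; apply: leq_mul.
      by apply: leq_trans (ci l _) le_i; have := ltn_ord l; lia.
    by apply: leq_trans (cj _ _) le_j; lia.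
  rewrite -mulnA leq_mul2r; apply/orP; right.
  by apply: leq_trans (leq_pexp2l _ (bs s.-1)) => //; lia.
Qed.

End ClearDenominators.

(** The fraction arithmetic never divides, so it commutes with ring maps out of [int], in particular
    with reduction modulo [N]. *)
Lemma frac_eval_intr (A : comNzRingType) m r (c : acircuit m r) S (a : 'I_r -> nat) :
  frac_eval (indic_line A S) (fun j => (a j)%:R) c =
  map_poly intr (int_eval c S a).
Proof.
have [topo out] := acircuit_ok c.
pose rel (i : nat) (u : {poly int} * int) (v : {poly A} * A) :=
  v.1 = map_poly intr u.1 /\ v.2 = u.2%:~R.
suff [] : rel (aoutput c)
  (frac_output (indic_line int S) (fun j => (a j)%:R) c)
  (frac_output (indic_line A S) (fun j => (a j)%:R) c) by [].
apply: (gate_values_rel (rel := rel) _ topo out).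
move=> vs1 vs2 [l|j|q|i j|i j] _ IH /=; rewrite /rel /=.
- by split; rewrite ?rmorph1 // /indic_line map_polyZ /= map_polyX rmorph_nat.
- by split; rewrite ?rmorph1 // map_polyC /= !rmorph_nat.
- by split; rewrite ?map_polyC /= !intz.
- move=> /and3P[/IH[-> ->] /IH[-> ->] _]; split; last by rewrite rmorphM.
  by rewrite rmorphD /= !map_polyZ.
- move=> /and3P[/IH[-> ->] /IH[-> ->] _]; split; last by rewrite rmorphM.
  by rewrite rmorphM.
Qed.

(** * Testing modulo a number with few bits *)

Lemma Zp_intr_eq0 N (z : int) : (1 < N)%N ->
  ((z%:~R : 'Z_N) == 0) = (N %| absz z)%N.
Proof.
move=> N1; have natr0 k : ((k%:R : 'Z_N) == 0) = (N %| k)%N.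
  by rewrite -val_eqE /= val_Zp_nat.
case: z => k; first by rewrite -natr0 pmulrn.
by rewrite NegzE mulrNz oppr_eq0 -pmulrn natr0.
Qed.

Lemma bit_length_ltn k : (k < 2 ^ bit_length k)%N.
Proof. exact: trunc_log_ltn. Qed.

Lemma agate_bits_le m r (c : acircuit m r) q :
  List.In (AConst m r q) (agates c) -> (rat_bits q <= acircuit_size c)%N.
Proof.
move=> qc; apply: leq_trans (leq_addl _ _).
elim: (agates c) qc => [//|g gs IH] /= [->|/IH qgs]; rewrite big_cons; first exact: leq_addr.
exact: leq_trans qgs (leq_addl _ _).
Qed.

(** One modulus must serve all sets. An [N] that does not divide the product [V] of the nonzero
    values over all [2 ^ d] sets divides none of these values. Since [V < 2 ^ M] with [M] singly
    exponential in [n + d + s], some such [N] is at most [2M + 1] and has polynomially many bits. *)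
Lemma modular_test (K : numFieldType) n r (c : acircuit (tensor_dim n) r) :
  (0 < n)%N -> succinctly_encodes (@tensor_act K n) c ->
  exists (N : nat) (y : 'I_r -> 'Z_N),
    [/\ (1 < N)%N,
        (N <= 2 ^ (n + 2 * tensor_dim n + 3 * acircuit_size c + 5))%N &
        forall S : {ffun 'I_(tensor_dim n) -> bool},
          perfect_matching (tensor_subset S) <->
          (frac_eval (indic_line 'Z_N S) y c)`_n != 0].
Proof.
move=> n0 enc; set d := tensor_dim n; set s := acircuit_size c.
have gs_s : (size (agates c) <= s)%N by apply: leq_addr.
have [a aP aS] := common_point K c n.
(* Enough bits for [n], for the parameters, which are at most [2 ^ d * 2 ^ s], and for the
   constants, whose numerators and denominators have at most [s] bits. *)
pose b := (n + d + s + 2)%N.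
pose v (S : {ffun 'I_d -> bool}) := absz ((int_eval c S a)`_n).
have vb S : (v S <= 2 ^ (b * 3 ^ s))%N.
  have h : (v S <= 2 ^ (b * 3 ^ size (agates c)))%N.
    apply: int_eval_bound.
    - by rewrite n0 /=; apply: (leq_trans (ltn_expl n (isT : 1 < 2)%N)); rewrite leq_exp2l // /b; lia.
    - by rewrite /b; lia.
    - move=> j; have := aP j; rewrite ltnS => /leq_trans; apply.
      rewrite -expnD leq_exp2l //; apply: leq_trans (leq_add (leqnn d) gs_s) _.
      by rewrite /b; lia.
    - move=> q /agate_bits_le; rewrite /rat_bits -/s => qs.
      have sb : (s <= b)%N by rewrite /b -addnA addnCA leq_addr.
      have bits k : (bit_length k <= s)%N -> (k <= 2 ^ b)%N.
        move=> ks; apply: ltnW; apply: leq_trans (bit_length_ltn k) _.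
        by rewrite leq_exp2l // (leq_trans ks sb).
      by split; apply: bits; apply: leq_trans qs; rewrite ?leq_addl // addnAC leq_addl.
  apply: leq_trans h _; rewrite leq_exp2l // leq_mul2l leq_exp2l // gs_s orbT //.
pose V := (\prod_(S : {ffun 'I_d -> bool} | v S != 0%N) v S)%N.
pose M := (b * 3 ^ s * 2 ^ d).+1.
have VM : (0 < V < 2 ^ M)%N.
  apply/andP; split; first by apply: prodn_cond_gt0 => S; rewrite lt0n.
  rewrite /M expnS mul2n -addnn; apply: (@leq_ltn_trans (2 ^ (b * 3 ^ s * 2 ^ d))).
    rewrite /V expnM (_ : 2 ^ d = #|{ffun 'I_d -> bool}|)%N; last first.
      by rewrite card_ffun card_bool card_ord.
    rewrite -prod_nat_const big_mkcond; apply: leq_prod => S _.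
    by case: ifP => // _; rewrite expn_gt0.
  by rewrite -[X in (X < _)%N]addn0 ltn_add2l expn_gt0.
have [N /andP[N1 NM] NV] := exists_nondivisor VM.
exists N, (fun j => (a j)%:R); split=> //.
  apply: leq_trans NM _.
  have b2 : (b <= 2 ^ b)%N by apply: ltnW; apply: ltn_expl.
  have s2 : (3 ^ s <= 2 ^ (2 * s))%N by rewrite expnM; case: (s) => [//|k]; rewrite leq_exp2r.
  have M2 : (b * 3 ^ s * 2 ^ d <= 2 ^ (b + 2 * s + d))%N.
    by rewrite (expnD 2 (b + 2 * s)) (expnD 2 b); apply: leq_mul => //; apply: leq_mul.
  have -> : (n + 2 * d + 3 * s + 5 = (b + 2 * s + d) + 3)%N by rewrite /b; lia.
  rewrite expnD /M; move: M2.
  have := expn_gt0 2 (b + 2 * s + d); rewrite /= => pos.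
  move: pos; set A := (2 ^ _)%N; set B := (_ * _ * _)%N; clearbody A B; clear; lia.
move=> S; rewrite frac_eval_intr coef_map /= Zp_intr_eq0 // -/(v S).
rewrite (encoding_matching S n0 enc); split.
  case=> alpha; rewrite restrict_line_eval => /aS.
  rewrite -int_eval_neq0 -absz_eq0 -/(v S) => vS.
  apply: contra NV => NvS; apply: dvdn_trans NvS _.
  by rewrite /V (bigD1 S) //= dvdn_mulr.
move=> NvS; exists (fun j => (a j)%:R); rewrite restrict_line_eval -int_eval_neq0 -absz_eq0 -/(v S).
by apply: contra NvS => /eqP ->; rewrite dvdn0.
Qed.

Local Close Scope ring_scope.

(** * Building Boolean circuits *)

Section Build.

Variable nin : nat.

Local Notation X := ('I_nin -> bool).
Local Notation gates := (seq (bgate nin)).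

Definition bvalues (gs : gates) (x : X) : seq bool :=
  gate_values (bgate_step x) gs.

Definition btopological (gs : gates) : bool := topological (@bgate_args nin) 0 gs.

Definition extends (gs gs' : gates) : Prop := exists t, gs' = gs ++ t.

Definition avail (gs : gates) (f : X -> bool) : Prop :=
  exists2 i, i < size gs & forall x, nth false (bvalues gs x) i = f x.

(** Circuits are constructed in a calculus of extensions in which [c] bounds the gates added. Gates
    are only appended, so facts about earlier gates persist. *)
Definition build (c : nat) (gs : gates) (Q : gates -> Prop) : Prop :=
  exists gs', [/\ extends gs gs', btopological gs', size gs' <= size gs + c & Q gs'].

Definition monotone (Q : gates -> Prop) : Prop :=
  forall gs gs', extends gs gs' -> Q gs -> Q gs'.

Lemma extends_refl gs : extends gs gs.
Proof. by exists [::]; rewrite cats0. Qed.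

Lemma extends_trans gs1 gs2 gs3 : extends gs1 gs2 -> extends gs2 gs3 -> extends gs1 gs3.
Proof. by case=> t -> [t' ->]; exists (t ++ t'); rewrite catA. Qed.

Lemma bvalues_cat gs t x i : i < size gs ->
  nth false (bvalues (gs ++ t) x) i = nth false (bvalues gs x) i.
Proof.
move=> igs; elim/last_ind: t => [|t g IH]; first by rewrite cats0.
rewrite /bvalues -rcons_cat gate_values_rcons nth_rcons size_gate_values size_cat.
by rewrite ltn_addr.
Qed.

Lemma avail_mono f : monotone (avail^~ f).
Proof.
move=> gs _ [t ->] [i igs fP]; exists i => [|x]; first by rewrite size_cat ltn_addr.
by rewrite bvalues_cat.
Qed.

Lemma avail_ext gs f g : f =1 g -> avail gs f -> avail gs g.
Proof. by move=> fg [i igs fP]; exists i => // x; rewrite fP fg. Qed.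

Lemma build_ret c gs (Q : gates -> Prop) : btopological gs -> Q gs -> build c gs Q.
Proof. by move=> tgs Qgs; exists gs; split=> //; [exact: extends_refl | exact: leq_addr]. Qed.

Lemma build_bind c1 c2 c gs (Q1 Q2 : gates -> Prop) : build c1 gs Q1 ->
  (forall gs', extends gs gs' -> btopological gs' -> Q1 gs' -> build c2 gs' Q2) ->
  c1 + c2 <= c -> build c gs Q2.
Proof.
case=> gs1 [e1 t1 s1 q1] h cc; have [gs2 [e2 t2 s2 q2]] := h _ e1 t1 q1.
by exists gs2; split=> //; [exact: extends_trans e1 e2 | lia].
Qed.

Lemma build_conseq c c' gs (Q Q' : gates -> Prop) : build c gs Q -> c <= c' ->
  (forall gs', Q gs' -> Q' gs') -> build c' gs Q'.
Proof.
move=> [gs1 [e1 t1 s1 q1]] cc QQ'; exists gs1; split=> //; last exact: QQ'.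
by apply: leq_trans s1 _; rewrite leq_add2l.
Qed.

Lemma build_weaken c gs (Q Q' : gates -> Prop) : build c gs Q ->
  (forall gs', extends gs gs' -> Q gs' -> Q' gs') -> build c gs Q'.
Proof. by case=> gs1 [e1 t1 s1 q1] h; exists gs1; split=> //; apply: h. Qed.

Lemma build_forall m c gs (Q : nat -> gates -> Prop) : btopological gs ->
  (forall k, monotone (Q k)) ->
  (forall k gs', k < m -> extends gs gs' -> btopological gs' -> build c gs' (Q k)) ->
  build (m * c) gs (fun gs' => forall k, k < m -> Q k gs').
Proof.
move=> tgs Qm; elim: m => [|m IH] h; first by apply: build_ret.
apply: (build_bind (c1 := m * c) (c2 := c)); last by rewrite mulSnr.
  by apply: IH => k gs' km; apply: h; rewrite ltnS ltnW.
move=> gs1 e1 t1 q1.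
apply: (build_bind (c2 := 0) (h m gs1 (ltnSn m) e1 t1)); last by rewrite addn0.
move=> gs2 e2 t2 q2; apply: build_ret => // k.
by rewrite ltnS leq_eqVlt => /orP[/eqP -> //|km]; apply: Qm e2 (q1 _ km).
Qed.

Lemma build_gate gs g : btopological gs ->
  all (fun j => j < size gs) (bgate_args g) ->
  build 1 gs (avail^~ (fun x => bgate_step x (bvalues gs x) g)).
Proof.
move=> tgs ga; exists (rcons gs g); split.
- by exists [:: g]; rewrite cats1.
- by rewrite /btopological topological_rcons; apply/andP.
- by rewrite size_rcons addn1.
- exists (size gs) => [|x]; first by rewrite size_rcons.
  by rewrite /bvalues gate_values_rcons nth_rcons size_gate_values ltnn eqxx.
Qed.

Section Logic.

Variables (gs : gates) (tgs : btopological gs).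

Lemma build_input i : build 1 gs (avail^~ (fun x => x i)).
Proof. exact: (build_gate (g := BIn i)). Qed.

Lemma build_const b : build 1 gs (avail^~ (fun=> b)).
Proof. exact: (build_gate (g := BConst nin b)). Qed.

Lemma build_not f : avail gs f -> build 1 gs (avail^~ (fun x => ~~ f x)).
Proof.
case=> i igs fP; have := @build_gate gs (BNot nin i) tgs.
rewrite /= igs => /(_ isT)/build_conseq; apply=> // gs'.
by apply: avail_ext => x; rewrite fP.
Qed.

Lemma build_and f g : avail gs f -> avail gs g ->
  build 1 gs (avail^~ (fun x => f x && g x)).
Proof.
case=> i igs fP [j jgs gP]; have := @build_gate gs (BAnd nin i j) tgs.
rewrite /= igs jgs => /(_ isT)/build_conseq; apply=> // gs'.
by apply: avail_ext => x; rewrite fP gP.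
Qed.

Lemma build_or f g : avail gs f -> avail gs g ->
  build 1 gs (avail^~ (fun x => f x || g x)).
Proof.
case=> i igs fP [j jgs gP]; have := @build_gate gs (BOr nin i j) tgs.
rewrite /= igs jgs => /(_ isT)/build_conseq; apply=> // gs'.
by apply: avail_ext => x; rewrite fP gP.
Qed.

End Logic.

Lemma build_mux gs s f g : btopological gs -> avail gs s -> avail gs f -> avail gs g ->
  build 4 gs (avail^~ (fun x => if s x then f x else g x)).
Proof.
move=> t0 as0 af0 ag0.
apply: (build_bind (c2 := 3) (build_and t0 as0 af0)) => // gs1 e1 t1 h1.
apply: (build_bind (c2 := 2) (build_not t1 (avail_mono e1 as0))) => // gs2 e2 t2 h2.
apply: (build_bind (c2 := 1) (build_and t2 h2 (avail_mono e2 (avail_mono e1 ag0)))) => // gs3 e3 t3 h3.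
apply: (build_conseq (build_or t3 (avail_mono e3 (avail_mono e2 h1)) h3)) => // gs4.
by apply: avail_ext => x; case: (s x) => //=; rewrite orbF.
Qed.

Lemma build_xor gs f g : btopological gs -> avail gs f -> avail gs g ->
  build 5 gs (avail^~ (fun x => f x (+) g x)).
Proof.
move=> t0 af0 ag0.
apply: (build_bind (c2 := 4) (build_not t0 ag0)) => // gs1 e1 t1 h1.
apply: (build_conseq (build_mux t1 (avail_mono e1 af0) h1 (avail_mono e1 ag0))) => // gs4.
by apply: avail_ext => x; case: (f x).
Qed.

(** Majority as a multiplexer on [a (+) b], so that the full adder reuses the gate already computed
    for the sum. *)
Definition majority (a b c : bool) : bool := if a (+) b then c else a.

Lemma build_full_adder gs f g h : btopological gs -> avail gs f -> avail gs g -> avail gs h ->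
  build 14 gs (fun gs' => avail gs' (fun x => f x (+) g x (+) h x) /\
                          avail gs' (fun x => majority (f x) (g x) (h x))).
Proof.
move=> t0 af ag ah.
apply: (build_bind (c2 := 9) (build_xor t0 af ag)) => // gs1 e1 t1 h1.
apply: (build_bind (c2 := 4) (build_xor t1 h1 (avail_mono e1 ah))) => // gs2 e2 t2 h2.
apply: (build_bind (c2 := 0) (build_mux t2 (avail_mono e2 h1)
  (avail_mono e2 (avail_mono e1 ah)) (avail_mono e2 (avail_mono e1 af)))) => // gs3 e3 t3 h3.
by apply: build_ret => //; split=> //; apply: avail_mono e3 h2.
Qed.

(** * Binary arithmetic *)

(** Bits are listed from the least significant. The base case forces the remaining quotient to be 0,
    so the number has at most [L] bits. *)
Fixpoint navail (L : nat) (gs : gates) (f : X -> nat) : Prop :=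
  if L is L'.+1 then
    avail gs (fun x => odd (f x)) /\ navail L' gs (fun x => (f x)./2)
  else forall x, f x = 0.

Lemma navail_mono L f : monotone (fun gs => navail L gs f).
Proof.
move=> gs gs' e; elim: L f => [//|L IH] f /= [h1 h2].
by split; [apply: avail_mono e h1 | apply: IH].
Qed.

Lemma navail_ext L gs f g : f =1 g -> navail L gs f -> navail L gs g.
Proof.
elim: L f g => [|L IH] f g fg /=; first by move=> f0 x; rewrite -fg.
case=> h1 h2; split; first by apply: avail_ext h1 => x; rewrite fg.
by apply: IH h2 => x; rewrite fg.
Qed.

Definition consts gs : Prop := avail gs (fun=> true) /\ avail gs (fun=> false).

Lemma consts_mono : monotone consts.
Proof. by move=> gs gs' e [h1 h2]; split; [apply: avail_mono e h1 | apply: avail_mono e h2]. Qed.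

Lemma avail_const gs b : consts gs -> avail gs (fun=> b).
Proof. by case: b => -[]. Qed.

Lemma half_lt_exp k L : k < 2 ^ L.+1 -> k./2 < 2 ^ L.
Proof. by rewrite expnS -{1}[k]odd_double_half -muln2; case: (odd k); lia. Qed.

Lemma navail_const L gs k : consts gs -> k < 2 ^ L -> navail L gs (fun=> k).
Proof.
move=> cgs; elim: L k => [|L IH] k kL /=; first by move: kL; rewrite expn0; case: k.
by split; [exact: avail_const | apply: IH; exact: half_lt_exp].
Qed.

Lemma navail_bool L gs f : consts gs -> 0 < L -> avail gs f ->
  navail L gs (fun x => nat_of_bool (f x)).
Proof.
case: L => // L cgs _ af /=; split; first by apply: avail_ext af => x; rewrite oddb.
apply: (@navail_ext _ _ (fun=> 0)); first by move=> x; case: (f x).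
by apply: navail_const; rewrite ?expn_gt0.
Qed.

(** Ripple-carry addition: the carry of each full adder becomes the incoming carry for the halves,
    and the last carry is the extra top bit. *)
Lemma build_add L gs f g c : btopological gs -> navail L gs f -> navail L gs g -> avail gs c ->
  build (14 * L) gs (fun gs' => navail L.+1 gs' (fun x => f x + g x + c x)).
Proof.
elim: L gs f g c => [|L IH] gs f g c t0 /=.
  move=> f0 g0 ac; apply: build_ret => //; split.
    by apply: avail_ext ac => x; rewrite f0 g0 oddb.
  by move=> x; rewrite f0 g0; case: (c x).
move=> [f1 f2] [g1 g2] ac; rewrite mulnS.
apply: (build_bind (build_full_adder t0 f1 g1 ac)) => // gs1 e1 t1 [h1 h2].
have := IH gs1 _ _ _ t1 (navail_mono e1 f2) (navail_mono e1 g2) h2.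
move/build_weaken; apply=> gs2 e2 h3; split.
  apply: avail_ext (avail_mono e2 h1) => x.
  by rewrite !oddD oddb.
apply: navail_ext h3 => x.
have := odd_double_half (f x); have := odd_double_half (g x).
by rewrite /majority; case: (odd (f x)); case: (odd (g x)); case: (c x) => /=; lia.
Qed.

Lemma build_nmux L gs s f g : btopological gs -> avail gs s -> navail L gs f -> navail L gs g ->
  build (4 * L) gs (fun gs' => navail L gs' (fun x => if s x then f x else g x)).
Proof.
elim: L gs f g => [|L IH] gs f g t0 as0 /=.
  by move=> f0 g0; apply: build_ret => // x; rewrite f0 g0; case: (s x).
move=> [f1 f2] [g1 g2]; rewrite mulnS.
apply: (build_bind (build_mux t0 as0 f1 g1)) => // gs1 e1 t1 h1.
have := IH gs1 _ _ t1 (avail_mono e1 as0) (navail_mono e1 f2) (navail_mono e1 g2).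
move/build_weaken; apply=> gs2 e2 h3; split.
  by apply: avail_ext (avail_mono e2 h1) => x; case: (s x).
by apply: navail_ext h3 => x; case: (s x).
Qed.

Lemma navail_top L gs f : navail L.+1 gs f -> avail gs (fun x => 2 ^ L <= f x).
Proof.
elim: L f => [|L IH] f /=.
  case=> af f0; apply: avail_ext af => x; have := f0 x.
  by case: (f x) => [|[|k]] //=.
case=> _ /IH; apply: avail_ext => x.
by rewrite expnS -{2}[f x]odd_double_half -muln2; set a := 2 ^ L; case: (odd _); lia.
Qed.

Lemma navail_mod L k gs f : navail (L + k) gs f -> navail L gs (fun x => f x %% 2 ^ L).
Proof.
elim: L f => [|L IH] f; first by move=> _ x; rewrite modn1.
have modE x : f x %% 2 ^ L.+1 = odd (f x) + (((f x)./2) %% 2 ^ L).*2.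
  rewrite -{1}[f x]odd_double_half -!muln2 expnSr.
  rewrite {1}(divn_eq (f x)./2 (2 ^ L)) mulnDl -mulnA addnCA modnMDl modn_small //.
  have := ltn_pmod (f x)./2 (_ : 0 < 2 ^ L); rewrite expn_gt0 => /(_ isT).
  by case: (odd _) => /=; lia.
move=> /= [h1 /IH h2]; split.
  by apply: avail_ext h1 => x; rewrite modE oddD odd_double addbF oddb.
by apply: navail_ext h2 => x; rewrite modE half_bit_double.
Qed.

Lemma build_nonzero L gs f : btopological gs -> consts gs -> navail L gs f ->
  build L gs (avail^~ (fun x => f x != 0)).
Proof.
elim: L gs f => [|L IH] gs f t0 cgs /=.
  by move=> f0; apply: build_ret => //; apply: avail_ext (avail_const false cgs) => x; rewrite f0.
case=> h1 /(IH _ _ t0 cgs) h2; rewrite -addn1.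
apply: (build_bind h2) => // gs1 e1 t1 h3.
apply: (build_conseq (build_or t1 (avail_mono e1 h1) h3)) => // gs2.
by apply: avail_ext => x; case: (f x) => [|[|k]] //=; rewrite orbT.
Qed.

End Build.

Arguments avail {nin}.

(** * Modular arithmetic *)

Section Modular.

Variables (nin N L : nat) (N1 : 1 < N) (NL : N <= 2 ^ L).

Local Notation X := ('I_nin -> bool).
Local Notation gates := (seq (bgate nin)).

Definition zavail (gs : gates) (f : X -> 'Z_N) : Prop :=
  navail L gs (fun x => nat_of_ord (f x)).

Lemma zavail_mono f : monotone (fun gs => zavail gs f).
Proof. exact: navail_mono. Qed.

Lemma zavail_ext gs f g : f =1 g -> zavail gs f -> zavail gs g.
Proof. by move=> fg; apply: navail_ext => x; rewrite fg. Qed.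

Lemma L_gt0 : 0 < L.
Proof. by move: NL; case: (L) => //; rewrite expn0; lia. Qed.

Lemma Zp_lt (a : 'Z_N) : a < N.
Proof. by have := ltn_ord a; rewrite [X in _ < X](Zp_cast N1). Qed.

Lemma Zp_addE (a b : 'Z_N) : nat_of_ord (a + b)%R = if N <= a + b then a + b - N else a + b.
Proof.
have -> : nat_of_ord (a + b)%R = (a + b) %% N by exact: (congr1 (modn _) (Zp_cast N1)).
have := Zp_lt a; have := Zp_lt b.
case: (leqP N (a + b)) => [Nab aN bN|abN _ _]; last by rewrite modn_small.
by rewrite -{1}(subnK Nab) modnDr modn_small; lia.
Qed.

Lemma zavail_const gs (k : 'Z_N) : consts gs -> zavail gs (fun=> k).
Proof.
by move=> cgs; apply: navail_const => //; apply: leq_trans (Zp_lt k) NL.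
Qed.

Lemma zavail_bool gs f : consts gs -> avail gs f ->
  zavail gs (fun x => (nat_of_bool (f x))%:R%R).
Proof.
move=> cgs /(navail_bool cgs L_gt0); apply: navail_ext => x.
by rewrite val_Zp_nat // modn_small //; case: (f x) => //; apply: ltnW.
Qed.

(** The sum [s] has [L.+1] bits. Adding [2 ^ L.+1 - N] to it sets the next bit exactly when
    [N <= s], and the lower bits are then [s - N]; that bit selects between [s - N] and [s]. The
    cost [14 L + 18 (L + 1)] is at most [50 L] because [L] is positive. *)
Lemma build_zadd gs f g : btopological gs -> consts gs -> zavail gs f -> zavail gs g ->
  build (50 * L) gs (fun gs' => zavail gs' (fun x => (f x + g x)%R)).
Proof.
move=> t0 c0 zf zg.
have := build_add t0 zf zg (avail_const false c0).
move/(build_bind (c2 := 18 * L.+1 )); apply; last by have := L_gt0; lia.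
move=> gs1 e1 t1; set s := fun x : X => _ => h1.
have k1 : 2 ^ L.+1 - N < 2 ^ L.+1.
  by rewrite -subn_gt0 subKn ?(ltnW N1) //; apply: leq_trans NL _; rewrite leq_exp2l.
have c1 := consts_mono e1 c0.
have := build_add t1 h1 (navail_const c1 k1) (avail_const false c1).
move/(build_bind (c2 := 4 * L.+1)); apply; last by lia.
move=> gs2 e2 t2; set u := fun x : X => _ => h2.
have h3 := navail_top h2.
have h4 : navail L.+1 gs2 (fun x => u x %% 2 ^ L.+1).
  by apply: (@navail_mod _ _ 1); rewrite addn1.
have := build_nmux t2 h3 h4 (navail_mono e2 h1).
move/build_weaken; apply=> gs3 e3 h5.
have /(@navail_mod _ L 1): navail (L + 1) gs3 (fun x => if 2 ^ L.+1 <= u x then u x %% 2 ^ L.+1 else s x).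
  by rewrite addn1.
apply: navail_ext => x; rewrite Zp_addE /u /s !addn0.
have P2 : 2 ^ L.+1 = 2 ^ L + 2 ^ L by rewrite expnS mul2n addnn.
have := Zp_lt (f x); have := Zp_lt (g x); move: (f x : nat) (g x : nat) => a b bN aN.
rewrite P2; move: NL; set A := 2 ^ L => NA.
have [Nab|abN] := leqP N (a + b).
  have -> : A + A <= a + b + (A + A - N) by lia.
  have -> : a + b + (A + A - N) = 1 * (A + A) + (a + b - N) by lia.
  by rewrite modnMDl !modn_small; lia.
have -> : A + A <= a + b + (A + A - N) = false by apply/negbTE; rewrite -ltnNge; lia.
by rewrite modn_small; lia.
Qed.

(** Double and add over the bits of [g]: per bit, one doubling and one addition of cost [50 * L]
    each, and a selection of cost [4 * L]. *)
Lemma build_zmulrn l gs f g : btopological gs -> consts gs -> zavail gs f ->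
  navail l gs g ->
  build (l * (104 * L)) gs (fun gs' => zavail gs' (fun x => (f x *+ g x)%R)).
Proof.
elim: l gs g => [|l IH] gs g t0 c0 zf /=.
  move=> g0; apply: build_ret => //.
  by apply: zavail_ext (zavail_const 0%R c0) => x; rewrite g0.
case=> g1 g2; rewrite mulSnr.
apply: (build_bind (IH _ _ t0 c0 zf g2)) => // gs1 e1 t1 h1.
have c1 := consts_mono e1 c0.
apply: (build_bind (c2 := 54 * L) (build_zadd t1 c1 h1 h1)); last by lia.
move=> gs2 e2 t2 h2; have c2 := consts_mono e2 c1.
have := build_nmux t2 (avail_mono e2 (avail_mono e1 g1))
  (zavail_mono e2 (zavail_mono e1 zf)) (zavail_const 0%R c2).
move/(build_bind (c2 := 50 * L)); apply; last by lia.
move=> gs3 e3 t3 h3; have c3 := consts_mono e3 c2.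
have h4 : zavail gs3 (fun x => if odd (g x) then f x else 0%R).
  by apply: navail_ext h3 => x; case: (odd _).
apply: (build_weaken (build_zadd t3 c3 (zavail_mono e3 h2) h4)) => gs4 _.
apply: zavail_ext => x.
rewrite -[X in (_ = f x *+ X)%R]odd_double_half mulrnDr -addnn mulrnDr addrC.
by congr (_ + _)%R; case: (odd _).
Qed.

Definition zmul_cost := L * (104 * L).

Lemma build_zmul gs f g : btopological gs -> consts gs -> zavail gs f -> zavail gs g ->
  build zmul_cost gs (fun gs' => zavail gs' (fun x => (f x * g x)%R)).
Proof.
move=> t0 c0 zf zg; apply: (build_weaken (build_zmulrn t0 c0 zf zg)) => gs1 _.
by apply: zavail_ext => x; rewrite -mulr_natr natr_Zp.
Qed.

Lemma build_zsum k c gs (F : nat -> X -> 'Z_N) : btopological gs -> consts gs ->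
  (forall i gs', i < k -> extends gs gs' -> btopological gs' ->
     build c gs' (fun gs'' => zavail gs'' (F i))) ->
  build (k * (c + 50 * L)) gs (fun gs' => zavail gs' (fun x => \sum_(i < k) F i x)%R).
Proof.
move=> t0 c0; elim: k => [|k IH] h.
  apply: build_ret => //; apply: zavail_ext (zavail_const 0%R c0) => x.
  by rewrite big_ord0.
have {}IH := IH (fun i gs' ik => h i gs' (ltn_trans ik (ltnSn k))).
rewrite mulSnr; apply: (build_bind IH) => // gs1 e1 t1 h1.
apply: (build_bind (h k gs1 (ltnSn k) e1 t1)) => // gs2 e2 t2 h2.
have c2 := consts_mono e2 (consts_mono e1 c0).
apply: (build_weaken (build_zadd t2 c2 (zavail_mono e2 h1) h2)) => gs3 _.
by apply: zavail_ext => x; rewrite big_ord_recr.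
Qed.

(** * Truncated polynomials and arithmetic circuits *)

Variable n : nat.

Definition pavail (gs : gates) (f : X -> {poly 'Z_N}) : Prop :=
  forall k, k < n.+1 -> zavail gs (fun x => (f x)`_k)%R.

(** A common bound for both polynomial operations: each of the [n.+1] coefficients is a convolution
    of at most [n.+1] products, or a combination of two products. *)
Definition pcost := n.+1 * (n.+1 * (zmul_cost + 50 * L) + 2 * zmul_cost + 50 * L).

Lemma build_pmul gs f g : btopological gs -> consts gs -> pavail gs f -> pavail gs g ->
  build pcost gs (fun gs' => pavail gs' (fun x => (f x * g x)%R)).
Proof.
move=> t0 c0 pf pg; rewrite /pavail /pcost.
apply: (build_forall (Q := fun k gs' => zavail gs' (fun x => (f x * g x)%R`_k)%R)) => //.
  by move=> k; apply: zavail_mono.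
move=> k gs1 kn e1 t1.
have c1 := consts_mono e1 c0.
have := @build_zsum k.+1 zmul_cost gs1 (fun i x => ((f x)`_i * (g x)`_(k - i))%R) t1 c1.
move=> /(_ _)/build_conseq; apply.
- move=> i gs2 ik e2 t2; apply: build_zmul => //; first exact: consts_mono e2 c1.
    by apply: zavail_mono e2 (zavail_mono e1 _); apply: pf; lia.
  by apply: zavail_mono e2 (zavail_mono e1 _); apply: pg; lia.
- have : k.+1 * (zmul_cost + 50 * L) <= n.+1 * (zmul_cost + 50 * L) by rewrite leq_mul2r kn orbT.
  by lia.
- by move=> gs2; apply: zavail_ext => x; rewrite coefM.
Qed.

Lemma build_plin gs f g (a b : 'Z_N) : btopological gs -> consts gs -> pavail gs f -> pavail gs g ->
  build pcost gs (fun gs' => pavail gs' (fun x => (a *: f x + b *: g x)%R)).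
Proof.
move=> t0 c0 pf pg; rewrite /pavail /pcost.
apply: (build_forall (Q := fun k gs' => zavail gs' (fun x => (a *: f x + b *: g x)%R`_k)%R)) => //.
  by move=> k; apply: zavail_mono.
move=> k gs1 kn e1 t1; have c1 := consts_mono e1 c0.
have h1 := build_zmul t1 c1 (zavail_const a c1) (zavail_mono e1 (pf k kn)).
apply: (build_bind (c2 := zmul_cost + 50 * L) h1); last by lia.
move=> gs2 e2 t2 h2; have c2 := consts_mono e2 c1.
have h3 := build_zmul t2 c2 (zavail_const b c2) (zavail_mono e2 (zavail_mono e1 (pg k kn))).
apply: (build_bind h3) => // gs3 e3 t3 h4.
apply: (build_weaken (build_zadd t3 (consts_mono e3 c2) (zavail_mono e3 h2) h4)) => gs4 _.
by apply: zavail_ext => x; rewrite coefD !coefZ.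
Qed.

Variables (m r : nat) (S : X -> 'I_m -> bool) (y : 'I_r -> 'Z_N).

Definition frac_values (gs : seq (agate m r)) (x : X) : seq ({poly 'Z_N} * 'Z_N) :=
  gate_values (frac_step (indic_line 'Z_N (S x)) y) gs.

Definition fvalue (gs : seq (agate m r)) (j : nat) (x : X) : {poly 'Z_N} * 'Z_N :=
  nth (0, 1)%R (frac_values gs x) j.

(** The denominators depend on the constants of the arithmetic circuit but not on the input, so they
    are hardwired. Adding fractions is then a linear combination with constant coefficients, and
    only numerators are computed by gates. *)
Lemma build_frac gs (ags : seq (agate m r)) : btopological gs -> consts gs ->
  (forall l, avail gs (fun x => S x l)) ->
  topological (@agate_args m r) 0 ags ->
  build (size ags * pcost) gs (fun gs' => forall j, j < size ags ->
    pavail gs' (fun x => (fvalue ags j x).1) /\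
    exists d, forall x, (fvalue ags j x).2 = d).
Proof.
move=> t0 c0 aS; elim/last_ind: ags => [|ags g IH] topo.
  by apply: build_ret.
move: topo; rewrite topological_rcons add0n => /andP[/IH {}IH gargs].
rewrite size_rcons mulSnr; apply: (build_bind IH) => // gs1 e1 t1 h1.
have c1 := consts_mono e1 c0.
have fold j x : j < size ags -> fvalue (rcons ags g) j x = fvalue ags j x.
  by move=> js; rewrite /fvalue /frac_values gate_values_rcons nth_rcons size_gate_values js.
have fnew x : fvalue (rcons ags g) (size ags) x =
    frac_step (indic_line 'Z_N (S x)) y (frac_values ags x) g.
  by rewrite /fvalue /frac_values gate_values_rcons nth_rcons size_gate_values ltnn eqxx.
pose done gs' := pavail gs' (fun x => (fvalue (rcons ags g) (size ags) x).1) /\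
  exists d, forall x, (fvalue (rcons ags g) (size ags) x).2 = d.
have new : build pcost gs1 done.
  have ret f d : pavail gs1 f -> (forall x, fvalue (rcons ags g) (size ags) x = (f x, d)) ->
     build pcost gs1 done.
    move=> pf fE; apply: build_ret => //; split; last by exists d => x; rewrite fE.
    by move=> k kn; apply: zavail_ext (pf k kn) => x; rewrite fE.
  have retC (a d : 'Z_N) : (forall x, fvalue (rcons ags g) (size ags) x = (a%:P, d)%R) ->
     build pcost gs1 done.
    by apply: ret => k kn; apply: zavail_const.
  case: g gargs fold fnew @done ret retC => [l|j|q|i j|i j] gargs fold fnew done ret retC.
  - apply: (ret _ 1%R _ fnew) => k kn.
    apply: (@zavail_ext _ (fun x => (S x l && (k == 1))%:R%R)).
      by move=> x; rewrite /indic_line coefZ coefX; case: (S x l); case: (k == 1)%N => /=; rewrite ?mulr0 ?mulr1 ?mul0r.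
    apply: zavail_bool => //; case: (k == 1).
      by apply: avail_ext (avail_mono e1 (aS l)) => x; rewrite andbT.
    by apply: avail_ext (avail_const false c1) => x; rewrite andbF.
  - exact: retC fnew.
  - exact: retC fnew.
  - move: gargs => /= /and3P[/h1[pi [di dii]] /h1[pj [dj djj]] _].
    apply: (build_weaken (build_plin dj di t1 c1 pi pj)) => gs2 _ h2.
    split=> [k kn|].
      apply: zavail_ext (h2 k kn) => x; rewrite fnew /= -/(fvalue ags i x) -/(fvalue ags j x).
      by rewrite dii djj.
    by exists (di * dj)%R => x; rewrite fnew /= -/(fvalue ags i x) -/(fvalue ags j x) dii djj.
  - move: gargs => /= /and3P[/h1[pi [di dii]] /h1[pj [dj djj]] _].
    apply: (build_weaken (build_pmul t1 c1 pi pj)) => gs2 _ h2.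
    split=> [k kn|].
      by apply: zavail_ext (h2 k kn) => x; rewrite fnew.
    by exists (di * dj)%R => x; rewrite fnew /= -/(fvalue ags i x) -/(fvalue ags j x) dii djj.
apply: (build_weaken new) => gs2 e2 h2 j; rewrite ltnS leq_eqVlt => /orP[/eqP -> //|js].
have [pj [d dP]] := h1 j js; split; last by exists d => x; rewrite fold.
by move=> k kn; apply: zavail_ext (zavail_mono e2 (pj k kn)) => x; rewrite fold.
Qed.

End Modular.

(** * The Boolean circuit for matching *)

Definition literal nin (f : ('I_nin -> bool) -> bool) : Prop :=
  (exists b, forall x, f x = b) \/ (exists i b, forall x, f x = (x i == b)).

Lemma literal_and nin (f : ('I_nin -> bool) -> bool) (b : bool) :
  literal f -> literal (fun x => b && f x).
Proof. by case: b => //= _; left; exists false. Qed.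

Lemma literal_or nin (f : ('I_nin -> bool) -> bool) (b : bool) :
  literal f -> literal (fun x => b || f x).
Proof. by case: b => //= _; left; exists true. Qed.

Lemma literal_ext nin (f g : ('I_nin -> bool) -> bool) :
  f =1 g -> literal f -> literal g.
Proof.
move=> fg [[b fb]|[i [b fb]]]; [left; exists b | right; exists i, b] => x; by rewrite -fg.
Qed.

Lemma literal_const nin (b : bool) : @literal nin (fun=> b).
Proof. by left; exists b. Qed.

Lemma build_literal nin (gs : seq (bgate nin)) f : btopological gs -> consts gs ->
  literal f -> build 2 gs (avail^~ f).
Proof.
move=> t0 c0 [[b fb]|[i [[] fb]]].
- by apply: build_ret => //; apply: avail_ext (avail_const b c0) => x; rewrite fb.
- apply: (build_conseq (build_input t0 i)) => // gs1; apply: avail_ext => x.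
  by rewrite fb eqb_id.
- apply: (build_bind (c2 := 1) (build_input t0 i)) => // gs1 e1 t1 h1.
  apply: (build_conseq (build_not t1 h1)) => // gs2; apply: avail_ext => x.
  by rewrite fb eqbF_neg.
Qed.

Lemma build_bcircuit nin c (f : ('I_nin -> bool) -> bool) :
  build c [::] (avail^~ f) ->
  exists2 bc : bcircuit nin, size (bgates bc) <= c & forall x, bcircuit_eval bc x = f x.
Proof.
case=> gs [_ tgs sgs [i igs fP]].
have ok : topological (@bgate_args nin) 0 gs && (i < size gs) by apply/andP.
by exists (BCircuit ok).
Qed.

(** The summands are the two constant gates, two gates for each of the [d] triples, [pcost] for each
    arithmetic gate with numbers of [n + 2 * d + 3 * s + 5] bits, and the final test against 0. *)
Definition circuit_bound (n d s : nat) : nat :=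
  2 + (d * 2 + (s * pcost (n + 2 * d + 3 * s + 5) n + (n + 2 * d + 3 * s + 5))).

Lemma matching_circuit (K : numFieldType) n r (c : acircuit (tensor_dim n) r) nin
    (S : ('I_nin -> bool) -> {ffun 'I_(tensor_dim n) -> bool}) :
  0 < n -> succinctly_encodes (@tensor_act K n) c ->
  (forall l, literal (fun x => S x l)) ->
  exists2 bc : bcircuit nin,
    size (bgates bc) <= circuit_bound n (tensor_dim n) (acircuit_size c) &
    forall x, perfect_matching (tensor_subset (S x)) <-> bcircuit_eval bc x.
Proof.
move=> n0 enc Slit.
have [N [y [N1 NL NS]]] := modular_test n0 enc.
set L := (n + _ + _ + 5) in NL.
have [topo out] := acircuit_ok c.
pose f x := ((frac_eval (indic_line 'Z_N (S x)) y c)`_n != 0)%R.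
suff /build_bcircuit[bc bcs bcE] : build (circuit_bound n (tensor_dim n) (acircuit_size c)) [::]
    (avail^~ f) by exists bc => // x; rewrite bcE NS.
apply: (build_bind (c1 := 2) (Q1 := @consts nin)) (leqnn _).
  apply: (build_bind (c2 := 1) (build_const (isT : btopological [::]) true)) => // gs1 e1 t1 h1.
  apply: (build_weaken (build_const t1 false)) => gs2 e2 h2.
  by split=> //; apply: avail_mono e2 h1.
move=> gs1 _ t1 c1.
apply: (build_bind (c1 := tensor_dim n * 2)
    (Q1 := fun gs => forall l, avail gs (fun x => S x l))) (leqnn _).
  have /build_weaken : build (tensor_dim n * 2) gs1 (fun gs => forall k, k < tensor_dim n ->
      forall l : 'I_(tensor_dim n), l = k :> nat -> avail gs (fun x => S x l)).
    apply: (build_forall (Q := fun k gs => forall l : 'I_(tensor_dim n), l = k :> nat ->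
      avail gs (fun x => S x l))) => //.
      by move=> k gs gs' e h l lk; apply: avail_mono e (h l lk).
    move=> k gs2 kd e2 t2.
    have := build_literal t2 (consts_mono e2 c1) (Slit (Ordinal kd)).
    move/build_weaken; apply=> gs3 _ h l lk.
    by have -> : l = Ordinal kd by apply: val_inj.
  by apply=> gs2 _ h l; apply: h (ltn_ord l) l erefl.
move=> gs2 e2 t2 aS; have c2 := consts_mono e2 c1.
have := @build_frac nin N L N1 NL n _ _ (fun x l => S x l) y gs2 (agates c) t2 c2 aS topo.
move/(build_bind (c2 := L)); apply; last by rewrite leq_add2r leq_mul2r leq_addr orbT.
move=> gs3 e3 t3 /(_ _ out) [/(_ n (ltnSn n)) pn _].
have := build_nonzero t3 (consts_mono e3 c2) pn.
by move/build_conseq; apply=> //.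
Qed.

(** * Nondeterministic machines and matchings *)

Section MachineMatching.

Variables (M : ntm) (k nin : nat).

Local Notation Sy := (option (bool + ntm_work M)).

Definition tab_set : finType := (tab_var k * tab_val M k)%type.
Definition tab_elt : finType := (tab_var k + tab_edge k * tab_label M k)%type.
Definition tab_vertex : finType := cover_vertex tab_set tab_elt.

Definition input_tape (x : 'I_nin -> bool) (p : nat) : Sy :=
  if insub p is Some i then Some (inl (x i)) else None.

Definition tab_triple (x : 'I_nin -> bool) : tab_vertex -> tab_vertex -> tab_vertex -> bool :=
  cover_triple (csp_mem (@tab_src k) (@tab_tgt k) (@tab_lsrc M k) (@tab_ltgt M k))
    (fun a : tab_set => tab_ok (input_tape x) a.1 a.2).

(** The input enters only through the contents of the cells at time 0, and each cell holds at most
    one input bit. *)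
Lemma tab_ok_literal v d : literal (fun x => @tab_ok M k (input_tape x) v d).
Proof.
case: v d => [t|[t p]] [[[[q h] a] s]|[[y y'] o]] /=; try exact: literal_const.
apply: literal_and; case: (_ == 0) => /=; last exact: literal_const.
rewrite /input_tape; case: insubP => [i _ _|_]; last exact: literal_const.
case: y => [[b|wk]|]; try exact: literal_const.
right; exists i, b => x.
by rewrite (inj_eq (@Some_inj _)) [LHS]/eq_op /= eq_sym.
Qed.

(** Only the admissibility test in [chosen_triple] involves the input; the wheels themselves are
    fixed. *)
Lemma tab_triple_literal u v z : literal (fun x => tab_triple x u v z).
Proof.
rewrite /tab_triple /cover_triple /chosen_triple; case: v => [[a e]|e]; last exact: literal_const.
apply: (@literal_ext _ (fun x => ((u == inl (a, cyc_succ e)) && (z == inl (a, e))) ||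
  ((u == inl (a, e)) && (z == if csp_mem (@tab_src k) (@tab_tgt k) (@tab_lsrc M k) (@tab_ltgt M k) a e then inr e else inl (a, e))
   && tab_ok (input_tape x) a.1 a.2))).
  by move=> x; rewrite [RHS]orbC; congr (_ || _); rewrite -andbA; congr (_ && _); rewrite andbC.
by apply: literal_or; apply: literal_and; apply: tab_ok_literal.
Qed.

Lemma good_run_matching (w : nin.-tuple bool) :
  (exists r, good_run k r (init_config M w)) <->
  perfect_matching (tab_triple (tnth w)).
Proof.
have inE : input_tape (tnth w) = ctape (init_config M w).
  apply/funext => p; rewrite /input_tape /= size_tuple.
  by case: insubP => [i pn <-|/negPf ->]; rewrite ?ltn_ord // (tnth_nth false).
have cE := csp_exact_cover (tab_ok (ctape (init_config M w))) (@tab_src k) (@tab_tgt k)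
  (@tab_lsrc M k) (@tab_ltgt M k).
rewrite /tab_triple inE; split=> [[r /good_run_tab/cE]|].
  exact: exact_cover_matching.
by move=> /matching_exact_cover/cE/tab_good_run.
Qed.

Definition tab_subset (x : 'I_nin -> bool) : {ffun 'I_(tensor_dim #|tab_vertex|) -> bool} :=
  [ffun l => let t := enum_val l in
    tab_triple x (enum_val t.1.1) (enum_val t.1.2) (enum_val t.2)].

Lemma tab_subset_matching x :
  perfect_matching (tab_triple x) <-> perfect_matching (tensor_subset (tab_subset x)).
Proof.
rewrite (perfect_matching_bij _ (@enum_rankK tab_vertex) (@enum_valK tab_vertex)).
suff -> : tensor_subset (tab_subset x) = fun a b c =>
    tab_triple x (enum_val a) (enum_val b) (enum_val c) by [].
apply/funext => a; apply/funext => b; apply/funext => c.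
by rewrite /tensor_subset ffunE enum_rankK.
Qed.

Lemma tab_subset_literal l : literal (fun x => tab_subset x l).
Proof.
apply: literal_ext (tab_triple_literal _ _ _) => x.
by rewrite ffunE.
Qed.

End MachineMatching.

(** * Polynomially bounded functions *)

Definition poly_bounded (f : nat -> nat) : Prop :=
  exists p : {poly nat}, forall n, f n <= p.[n]%R.

(** Coefficients in [nat] make polynomials monotone, which is what closes polynomial bounds under
    composition. *)
Lemma horner_nat_mono (p : {poly nat}) a b : a <= b -> p.[a]%R <= p.[b]%R.
Proof.
move=> ab; rewrite !horner_coef; apply: leq_sum => i _.
apply: leq_mul => //; elim: (i : nat) => [//|j IH].
by rewrite !exprS; apply: leq_mul.
Qed.

Lemma poly_bounded_ext f g : f =1 g -> poly_bounded g -> poly_bounded f.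
Proof. by move=> fg [p gp]; exists p => n; rewrite fg. Qed.

Lemma poly_bounded_const c : poly_bounded (fun=> c).
Proof. by exists (c%:P)%R => n; rewrite hornerC. Qed.

Lemma poly_bounded_id : poly_bounded id.
Proof. by exists 'X%R => n; rewrite hornerX. Qed.

Lemma poly_bounded_add f g : poly_bounded f -> poly_bounded g ->
  poly_bounded (fun n => f n + g n).
Proof. by move=> [p fp] [q gq]; exists (p + q)%R => n; rewrite hornerD; apply: leq_add. Qed.

Lemma poly_bounded_mul f g : poly_bounded f -> poly_bounded g ->
  poly_bounded (fun n => f n * g n).
Proof. by move=> [p fp] [q gq]; exists (p * q)%R => n; rewrite hornerM; apply: leq_mul. Qed.

Lemma poly_bounded_succ f : poly_bounded f -> poly_bounded (fun n => (f n).+1).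
Proof.
move=> [p fp]; exists (p + 1%:P)%R => n; rewrite hornerD hornerC.
by have := fp n; rewrite -(leq_add2r 1) addn1.
Qed.

Lemma poly_bounded_comp (p : {poly nat}) f : poly_bounded f ->
  poly_bounded (fun n => p.[f n]%R).
Proof.
move=> [q fq]; exists (p \Po q)%R => n; rewrite horner_comp.
exact: horner_nat_mono.
Qed.

(* The goals are matched syntactically, since unification up to conversion
   would unfold numerals. *)
Ltac poly_bounded_tac :=
  repeat lazymatch goal with
    | |- poly_bounded (fun=> ?c) => exact: (poly_bounded_const c)
    | |- poly_bounded (fun n => _ + _) => apply: poly_bounded_add
    | |- poly_bounded (fun n => _ * _) => apply: poly_bounded_mul
    | |- poly_bounded (fun n => _.+1) => apply: poly_bounded_succ
    | |- poly_bounded (fun n => horner _ _) => apply: poly_bounded_comp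
    | |- _ => assumption
  end.

Lemma tensor_dimE n : tensor_dim n = n * n * n.
Proof. by rewrite /tensor_dim !card_prod !card_ord. Qed.

Lemma circuit_bound_poly (f g h : nat -> nat) :
  poly_bounded f -> poly_bounded g -> poly_bounded h ->
  poly_bounded (fun n => circuit_bound (f n) (g n) (h n)).
Proof.
by move=> pf pg ph; rewrite /circuit_bound /pcost /zmul_cost; poly_bounded_tac.
Qed.

Lemma circuit_bound_mono n d s s' : s <= s' -> circuit_bound n d s <= circuit_bound n d s'.
Proof.
move=> ss'; rewrite /circuit_bound /pcost /zmul_cost.
by repeat match goal with
  | |- is_true (?x <= ?x) => exact: leqnn
  | |- is_true (_ + _ <= _ + _) => apply: leq_add
  | |- is_true (_ * _ <= _ * _) => apply: leq_mul
  | |- _ => assumption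
end.
Qed.

Lemma card_tab_vertex_poly (M : ntm) (k : nat -> nat) : poly_bounded k ->
  poly_bounded (fun n => #|tab_vertex M (k n)|).
Proof.
move=> pk.
apply: (@poly_bounded_ext _ (fun n => #|tab_set M (k n)| * #|tab_elt M (k n)| + #|tab_elt M (k n)|)) => [n|].
  by rewrite card_sum card_prod.
suff [ps pe] : poly_bounded (fun n => #|tab_set M (k n)|) /\ poly_bounded (fun n => #|tab_elt M (k n)|).
  by poly_bounded_tac.
split.
  apply: poly_bounded_ext => [n|].
    by rewrite card_prod !card_sum !card_prod !card_option !card_prod !card_ord.
  by poly_bounded_tac.
apply: poly_bounded_ext => [n|].
  by rewrite card_sum card_prod !card_sum !card_prod !card_option !card_sum !card_option !card_prod !card_ord.
by poly_bounded_tac.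
Qed.

(** * From succinct encodings to NP in P/poly *)

Local Open Scope ring_scope.

Theorem theorem1p8 (R : realType)
    (NP_not_sub_Ppoly : ~ (forall L : language, NP L -> Ppoly L)) :
  ~ (exists q : {poly nat}, forall n : nat, (1 <= n)%N ->
       exists (r : nat) (c : acircuit (tensor_dim n) r),
         succinctly_encodes (@tensor_act R[i] n) c /\
         (acircuit_size c <= q.[n])%N).
Proof.
case=> q qP; apply: NP_not_sub_Ppoly => L [M [p [Mp LM]]].
(* One step more than the time bound, as [accepts_good_run] requires. *)
pose k n := (p.[n]%R).+1.
pose V n := #|tab_vertex M (k n)|.
have pV : poly_bounded V.
  by apply: card_tab_vertex_poly; apply: poly_bounded_succ; apply: poly_bounded_comp; apply: poly_bounded_id.
have [P PP] : poly_bounded (fun n => circuit_bound (V n) (V n * V n * V n) q.[V n]%R).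
  by apply: circuit_bound_poly; poly_bounded_tac.
exists P => n.
have V0 : (0 < V n)%N.
  by apply/card_gt0P; exists (inr (inl (inl ord0))).
(* The encoding is taken at tensor size [V n], which is polynomial in the input length [n], so its
   size [q.[V n]] is polynomial in [n] as well. *)
have [r [c [enc cq]]] := qP _ V0.
have [bc bcs bcE] := matching_circuit V0 enc (@tab_subset_literal M (k n) n).
exists bc => [|w].
  apply: leq_trans bcs (leq_trans _ (PP n)); rewrite -tensor_dimE.
  exact: circuit_bound_mono.
rewrite -bcE -tab_subset_matching -good_run_matching LM.
have := @accepts_good_run M (fun n => p.[n]%R) w Mp.
by rewrite size_tuple.
Qed.
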